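(* Let $p>5$ be a prime. If $p\equiv 2\pmod 3$, then $$\sum_{k=0}^{p-1}\frac{\binom{2k}{k}\binom{3k}{k}\binom{6k}{3k}}{54000^k}\equiv 0\pmod{p^2}.$$ If $p\equiv 1\pmod 3$ and so $p=A^2+3B^2$ with $A,B\in\mathbb{Z}$, then $$\sum_{k=0}^{p-1}\frac{\binom{2k}{k}\binom{3k}{k}\binom{6k}{3k}}{54000^k}\equiv \left(\frac{p}{5}\right)4A^2\pmod p.$$
   Context: $\left(\frac{p}{5}\right)$ denotes the Legendre symbol. Congruences modulo $p$ and $p^2$ are in the ring of rational numbers whose denominator is coprime to $p$. *)

(* Defs.v *)
From mathcomp Require Import all_boot all_order all_algebra.

Set Implicit Arguments.
Unset Strict Implicit.
Unset Printing Implicit Defensive.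

Import Order.TTheory GRing.Theory Num.Theory.
Local Open Scope ring_scope.

(* The Legendre symbol (a / q), meaningful for q an odd prime. *)
Definition legendre (a : int) (q : nat) : int :=
  if (q%:Z %| a)%Z then 0
  else if [exists x : 'I_q, ((x%:Z ^+ 2)%R == a %[mod q%:Z])%Z] then 1
  else -1.

(* Membership in the ring of rationals whose denominator is coprime to p. *)
Definition p_integral (p : nat) (x : rat) : bool := coprime `|denq x|%N p.

(* x = y modulo m in the ring above, i.e. modulo the ideal generated by m
   there. *)
Definition rat_congr (p m : nat) (x y : rat) : Prop :=
  [/\ p_integral p x, p_integral p y
    & exists2 z : rat, p_integral p z & x - y = m%:R * z].

(* Main.v *)
Require Import Defs.
From mathcomp Require Import all_boot all_order all_algebra.
From mathcomp Require Import all_field all_solvable.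
From mathcomp Require Import zify ring.

Import Order.TTheory GRing.Theory Num.Theory.
Local Open Scope ring_scope.

(** The sum is a truncated hypergeometric series attached to the elliptic
    curves with complex multiplication by the order of discriminant -12, whose
    j-invariant is 54000.  Put a_k = (6k)! / (k! (2k)! (3k)!), so that the k-th
    term has numerator c_k = C(2k,k) a_k.

    First, Clausen's formula says that the power series sum c_k (x(1 - 432x))^k
    is the square of sum a_k x^k.  Truncating both series at k < p costs nothing
    modulo p^2, because every coefficient of degree at least p on either side is
    divisible by p^2 ([clausen_mod_p2]).  With w^2 = 5 the point
    x = (25 - 11w) / 21600 satisfies x(1 - 432x) = 1/54000, so the sum is the
    square of A(x) = sum_{k<p} a_k x^k modulo p^2, computed in a ring containing
    a square root of 5.

    Secondly, A(x) modulo p is a Hasse invariant.  Expanding around the nodal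
    cubic X^2 (X + 3), the coefficient of X^(p-1) in
    (X^2 (X + 3) - 1728 x)^((p-1)/2) is 3^((p-1)/2) A(x).  Such a coefficient is
    minus the sum of the values over F_p, so it does not change under the shift
    X -> X + 1, and rescaling X by w turns the shifted cubic into
    X^3 - 15X + 22.  Hence w^((p-1)/2) 3^((p-1)/2) A(x) is minus the character
    sum of X^3 - 15X + 22 ([acoef_sum_cm12]).  A 2-isogeny, made explicit by
    counting the roots of a quadratic, replaces this cubic by X^3 + 1
    ([sum_qchar_cm12]).

    Thirdly, let S be the character sum of X^3 + 1.  If p = 2 mod 3, then
    cubing permutes F_p and S = 0, so A(x) vanishes modulo p for both choices
    of w, and its square vanishes modulo p^2.  Working with 2 x 2 matrices, where
    5 has an integral square root, makes this argument work whether or not 5 is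
    a square modulo p.  If p = 1 mod 3, the second moment of the sums of
    X^3 + c gives a binary form identity which, together with the parity of S,
    yields S = 2A with p = A^2 + 3B^2 ([cubic_sum_form]); such an A is unique up
    to sign.  Squaring the relation for A(x) leaves the factor
    5^((p-1)/2), which is the Legendre symbol (p/5) by a quadratic Gauss sum
    ([legendre5_euler]). *)

(** * Clausen's formula for Legendre polynomials *)

(** With s = X(1 - X), this is the symmetric square of the Legendre operator
    y -> (s y')' + N y: it kills the products of two solutions. *)
Definition clausen_op (N : int) (z : {poly int}) : {poly int} :=
  let s := 'X * (1 - 'X) in
  (s * (s * z^`())^`())^`() + (2 * N)%:P * ((s * z)^`() + s * z^`()).

(** Put z = y^2 and T = s y'^2.  The equation for y gives
    (s z')' = 2T - 2N z and (s T)' = - N s z', which eliminates T. *)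
Lemma clausen_op_sqr (N : int) (y : {poly int}) :
  ('X * (1 - 'X) * y^`())^`() = - N%:P * y -> clausen_op N (y ^+ 2) = 0.
Proof.
rewrite /clausen_op; set s := 'X * (1 - 'X) => Hy.
have d2 : (y ^+ 2)^`() = 2%:P * (y * y^`()) by rewrite expr2 derivM; ring.
have E1 : (s * (y ^+ 2)^`())^`() = 2%:P * (s * y^`() ^+ 2) - (2 * N)%:P * y ^+ 2.
  have -> : s * (y ^+ 2)^`() = 2%:P * (y * (s * y^`())) by rewrite d2; ring.
  by rewrite derivM derivC mul0r add0r derivM Hy; ring.
have E2 : s * (s * (y ^+ 2)^`())^`() =
    2%:P * (s * y^`()) ^+ 2 - (2 * N)%:P * (s * y ^+ 2).
  by rewrite E1; ring.
have -> : (s * (s * (y ^+ 2)^`())^`())^`() =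
   4%:P * (s * y^`()) * (- N%:P * y) - (2 * N)%:P * (s * y ^+ 2)^`().
  rewrite E2 derivB !(derivM _%:P) !derivC !mul0r !add0r expr2 derivM Hy; ring.
rewrite d2; ring.
Qed.

(** Since s'' = -2 and s'^2 = 1 - 4s, the chain rule turns the operator on
    C(s) into s' times a hypergeometric operator on C, written here with
    theta = X d/dX. *)
Lemma clausen_op_comp (N : int) (C : {poly int}) :
  let th := fun q : {poly int} => 'X * q^`() in
  (th (th C) - 'X * ((4 : int)%:P * th (th C) + (2 : int)%:P * th C))^`()
    + (2 * N)%:P * (('X * C)^`() + 'X * C^`()) = 0 ->
  clausen_op N (C \Po ('X * (1 - 'X))) = 0.
Proof.
move=> th HC; rewrite /clausen_op; set s := 'X * (1 - 'X).
have ds : s^`() = 1 - 2%:P * 'X :> {poly int}.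
  by rewrite /s derivM derivB derivX derivC; ring.
have thE q : s * (q \Po s)^`() = s^`() * (th q \Po s).
  by rewrite deriv_comp /th comp_polyM comp_polyX; ring.
have -> : s * (s * (C \Po s)^`())^`() =
  (th (th C) - 'X * ((4 : int)%:P * th (th C) + (2 : int)%:P * th C)) \Po s.
  rewrite thE derivM mulrDr [s * (s^`() * _)]mulrCA thE.
  have -> : s^`()^`() = - 2%:P :> {poly int}.
    rewrite ds derivB derivM !derivC derivX; ring.
  move: (th (th C)) (th C) => u v.
  rewrite !(comp_polyB, comp_polyM, comp_polyD, comp_polyC, comp_polyX).
  rewrite ds /s; ring.
have -> : s * (C \Po s) = ('X * C) \Po s by rewrite comp_polyM comp_polyX.
rewrite !deriv_comp.
have -> : s * ((C^`() \Po s) * s^`()) = (('X * C^`()) \Po s) * s^`().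
  by rewrite comp_polyM comp_polyX mulrA.
move: HC; set a := (_ - _)^`(); set b := ('X * C)^`(); move: a b ('X * C^`()) => a b c HC.
rewrite -[RHS](mul0r s^`()) -[in RHS](comp_poly0 s) -HC.
rewrite !comp_polyD comp_polyM comp_polyC comp_polyD.
ring.
Qed.

(** The indicial polynomial of the operator at 0 is k^3, so a solution
    divisible by X^k with k > 0 is divisible by X^(k+1). *)
Lemma clausen_op_inj0 (N : int) (z : {poly int}) :
  clausen_op N z = 0 -> z`_0 = 0 -> z = 0.
Proof.
move=> Hz z0.
suff dvd k : (0 < k)%N -> exists q, z = 'X^k * q.
  apply/polyP => i; have [q ->] := dvd i.+1 isT.
  by rewrite coefXnM ltnSn coef0.
elim: k => // -[_ _|k IHk _].
  have : root z 0 by rewrite rootE horner_coef0 z0.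
  by case/factor_theorem => q ->; exists q; rewrite subr0 mulrC expr1.
have [//|q zE] := IHk.
have d i (r : {poly int}) :
    ('X^(i.+1) * r)^`() = 'X^i * (i.+1%:R * r + 'X * r^`()).
  by rewrite derivM derivXn /= exprS -mulr_natl; ring.
set a : {poly int} := k.+1%:R.
pose q1 : {poly int} := (1 - 'X) * (a * q + 'X * q^`()).
pose q2 : {poly int} := (1 - 'X) * (a * q1 + 'X * q1^`()).
have E1 : 'X * (1 - 'X) * z^`() = 'X^(k.+1) * q1.
  by rewrite zE d /q1 exprS -/a; ring.
have E2 : 'X * (1 - 'X) * ('X^(k.+1) * q1)^`() = 'X^(k.+1) * q2.
  by rewrite d /q2 exprS -/a; ring.
have E3 : 'X * (1 - 'X) * z = 'X^(k.+2) * ((1 - 'X) * q).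
  by rewrite zE [in RHS]exprS; ring.
move: Hz; rewrite /clausen_op E1 E2 E3 !d -/a exprS.
rewrite [X in X = 0](_ : _ = 'X^k * (a * q2 + 'X *
   (q2^`() + (2 * N)%:P * ((k.+2%:R * ((1 - 'X) * q) + 'X * ((1 - 'X) * q)^`())
       + q1)))); last by ring.
move/eqP; rewrite mulf_eq0 expf_eq0 polyX_eq0 andbF /= => /eqP/(congr1 (horner_eval 0)).
rewrite /horner_eval /q2 /q1 /a !hornerE /= => H.
have/eqP : q.[0] * (k.+1%:R ^+ 3) = 0 by rewrite -[RHS]H hornerMn hornerC; ring.
rewrite mulf_eq0 expf_eq0 pnatr_eq0 /= orbF => q0.
have/factor_theorem[r rE] : root q 0 by [].
by exists r; rewrite zE rE subr0 [in RHS]exprSr -mulrA [r * _]mulrC.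
Qed.

Lemma coef_theta (q : {poly int}) k : ('X * q^`())`_k = k%:R * q`_k.
Proof.
by rewrite coefXM; case: k => [|k]; rewrite /= ?mul0r // coef_deriv mulr_natl.
Qed.

(** Clausen's formula in polynomial form.  The recurrences on coefficients
    express the two differential equations, and the two sides are solutions of
    the same third order equation with the same value at 0. *)
Lemma clausen_poly (N : int) (y C : {poly int}) :
  (forall k, (k.+1%:R ^+ 2) * y`_k.+1 = (k%:R * k.+1%:R - N) * y`_k) ->
  (forall k, (k.+1%:R ^+ 3) * C`_k.+1 =
      2 * (2 * k%:R + 1) * (k%:R * k.+1%:R - N) * C`_k) ->
  C`_0 = y`_0 ^+ 2 -> y ^+ 2 = C \Po ('X * (1 - 'X)).
Proof.
move=> Hy HC H0; apply/eqP; rewrite -subr_eq0; apply/eqP.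
apply: (@clausen_op_inj0 N); last first.
  rewrite coefB -!horner_coef0 horner_exp horner_comp !hornerE ?mul0r.
  by rewrite horner_coef0 horner_coef0 H0 subrr.
have opB u v : clausen_op N (u - v) = clausen_op N u - clausen_op N v.
  rewrite /clausen_op !(derivB, mulrBr); ring.
rewrite opB clausen_op_sqr ?clausen_op_comp ?subr0 //.
- apply/polyP => k.
  rewrite coefD coef_deriv coefCM coefB coefD coef_deriv [in X in _ + X]coefXM.
  rewrite !coef_theta [in X in X + _]coefXM /= coefD !coefCM !coef_theta.
  rewrite coef0.
  transitivity (k.+1%:R ^+ 3 * C`_k.+1
    - 2 * (2 * k%:R + 1) * (k%:R * k.+1%:R - N) * C`_k); first by ring.
  by rewrite HC subrr.
- apply/polyP => k; rewrite coef_deriv -polyCN coefCM.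
  rewrite (_ : _ * y^`() = 'X * y^`() - 'X * ('X * y^`())); last by ring.
  rewrite coefB coef_theta coefXM /= coef_theta.
  transitivity (k.+1%:R ^+ 2 * y`_k.+1 - k%:R * k.+1%:R * y`_k); first by ring.
  rewrite Hy; ring.
Qed.

(** * Binomial coefficients *)

Lemma mul_bin_central k :
  (k.+1 * 'C(2 * k.+1, k.+1) = 2 * (2 * k + 1) * 'C(2 * k, k))%N.
Proof.
have e1 := mul_bin_diag (2 * k + 2) k.
have e2 := mul_bin_down (2 * k + 1) k.
rewrite (_ : (2 * k + 2).-1 = 2 * k + 1)%N in e1; last by lia.
rewrite (_ : (2 * k + 1).-1 = 2 * k)%N in e2; last by lia.
rewrite (_ : 2 * k + 1 - k = k.+1)%N in e2; last by lia.
rewrite (_ : 2 * k.+1 = 2 * k + 2)%N; last by lia.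
rewrite -e1 (_ : 2 * k + 2 = 2 * k.+1)%N; last by lia.
by rewrite -!mulnA e2.
Qed.

(** Coefficients of the Legendre polynomial P_n(1 - 2X). *)
Definition legendre_coef (n k : nat) : int := (-1) ^+ k * ('C(n, k) * 'C(n + k, k))%:R.

Lemma legendre_coefS n k :
  (k.+1%:R ^+ 2) * legendre_coef n k.+1 =
  (k%:R * k.+1%:R - n%:R * n.+1%:R) * legendre_coef n k.
Proof.
rewrite /legendre_coef !natrM.
have e1 : k.+1%:R * 'C(n, k.+1)%:R = (n%:R - k%:R) * 'C(n, k)%:R :> int.
  have [le|lt] := leqP k n; last by rewrite !bin_small ?mulr0 // ltnW.
  by rewrite -natrB // -!natrM mul_bin_left.
have e2 : k.+1%:R * 'C(n + k.+1, k.+1)%:R = (n%:R + k.+1%:R) * 'C(n + k, k)%:R :> int.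
  by rewrite -natrD -!natrM addnS -mul_bin_diag.
transitivity ((-1) ^+ k.+1 * (k.+1%:R * 'C(n, k.+1)%:R) *
    (k.+1%:R * 'C(n + k.+1, k.+1)%:R) : int).
  ring.
rewrite e1 e2 exprS; ring.
Qed.

Lemma coef_poly_ord (R : nzRingType) n (E : nat -> R) k :
  (forall j, (n < j)%N -> E j = 0) -> (\poly_(i < n.+1) E i)`_k = E k.
Proof. by move=> H; rewrite coef_poly ltnS; case: leqP => // /H. Qed.

Lemma legendre_sqr n :
  (\poly_(k < n.+1) legendre_coef n k) ^+ 2 =
  (\poly_(k < n.+1) (legendre_coef n k * 'C(2 * k, k)%:R)) \Po ('X * (1 - 'X)).
Proof.
have z k : (n < k)%N -> legendre_coef n k = 0.
  by move=> lt; rewrite /legendre_coef bin_small // mulr0.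
apply: (@clausen_poly (n%:R * n.+1%:R)).
- by move=> k; rewrite !coef_poly_ord //; apply: legendre_coefS.
- move=> k; rewrite !coef_poly_ord; try by move=> j lt; rewrite z // mul0r.
  rewrite exprS.
  transitivity ((k.+1%:R ^+ 2 * legendre_coef n k.+1) * (k.+1 * 'C(2 * k.+1, k.+1))%:R).
    rewrite natrM; ring.
  rewrite legendre_coefS mul_bin_central !natrM natrD natrM; ring.
- by rewrite !coef_poly /= /legendre_coef !bin0.
Qed.

(** This is (6k)! / (k! (2k)! (3k)!). *)
Definition acoef (k : nat) : nat := 'C(6 * k, 3 * k) * 'C(3 * k, k).
Definition ccoef (k : nat) : nat := 'C(2 * k, k) * 'C(3 * k, k) * 'C(6 * k, 3 * k).

Lemma ccoefE k : ccoef k = ('C(2 * k, k) * acoef k)%N.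
Proof. by rewrite /ccoef /acoef -mulnA [('C(3 * k, k) * _)%N]mulnC. Qed.

Lemma acoef_fact k : (acoef k * (k`! * (2 * k)`! * (3 * k)`!) = (6 * k)`!)%N.
Proof.
have := @bin_fact (6 * k) (3 * k); rewrite (_ : 6 * k - 3 * k = 3 * k)%N; last by lia.
have := @bin_fact (3 * k) k; rewrite (_ : 3 * k - k = 2 * k)%N; last by lia.
rewrite /acoef => <-; last by lia.
move=> <-; last by lia.
ring.
Qed.

Lemma acoefS k : (k.+1 ^ 2 * acoef k.+1 = 12 * ((6 * k + 1) * (6 * k + 5)) * acoef k)%N.
Proof.
have := acoef_fact k.+1; have := acoef_fact k.
rewrite (_ : 6 * k.+1 = (6 * k).+4.+2)%N; last by lia.
rewrite (_ : 3 * k.+1 = (3 * k).+3)%N; last by lia.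
rewrite (_ : 2 * k.+1 = (2 * k).+2)%N; last by lia.
rewrite !factS => <-.
set K := (k`! * (2 * k)`! * (3 * k)`!)%N => H.
have K0 : (0 < K)%N by rewrite !muln_gt0 !fact_gt0.
have D0 : (0 < 2 * ((2 * k).+1 * ((3 * k).+1 * ((3 * k).+2 * (3 * k).+3))))%N by lia.
apply/eqP; rewrite -(eqn_pmul2l D0) -(eqn_pmul2r K0); apply/eqP.
transitivity (acoef k.+1 *
    (k.+1 * k`! * ((2 * k).+2 * ((2 * k).+1 * (2 * k)`!)) *
     ((3 * k).+3 * ((3 * k).+2 * ((3 * k).+1 * (3 * k)`!)))))%N.
  rewrite /K; ring.
rewrite H; ring.
Qed.

(** * Divisibility by a prime *)

Lemma prime_mod6 p : prime p -> (3 < p)%N -> (p %% 6 = 1)%N \/ (p %% 6 = 5)%N.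
Proof.
move=> pp p3.
have n2 : ~~ (2 %| p)%N by rewrite dvdn_prime2 //; lia.
have n3 : ~~ (3 %| p)%N by rewrite dvdn_prime2 //; lia.
lia.
Qed.

Section Valuations.
Variables (p : nat) (pp : prime p) (p5 : (5 < p)%N).

Lemma coprime_lt_prime k : (0 < k < p)%N -> coprime p k.
Proof.
move=> /andP[k0 kp]; rewrite prime_coprime //; apply/negP => /dvdn_leq; lia.
Qed.

Lemma coprime_fact_lt_prime k : (k < p)%N -> coprime p k`!.
Proof.
elim: k => [|k IHk] kp; first exact: coprimen1.
by rewrite factS coprimeMr coprime_lt_prime // IHk // ltnW.
Qed.

Lemma dvdn_acoefS e k : (k.+1 < p)%N ->
  (p ^ e %| (6 * k + 1) * (6 * k + 5) * acoef k)%N -> (p ^ e %| acoef k.+1)%N.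
Proof.
move=> kp H.
have co : coprime (p ^ e) (k.+1 ^ 2).
  by rewrite coprimeXl // coprimeXr // coprime_lt_prime.
by rewrite -(Gauss_dvdr _ co) acoefS -mulnA dvdn_mull.
Qed.

(** For some j < k the factor 6j + 1 or 6j + 5 of the recurrence is p, and the
    factors (j + 1)^2 that it divides by are prime to p. *)
Lemma dvdn_acoef k : (k < p)%N -> (p < 6 * k)%N -> (p %| acoef k)%N.
Proof.
elim: k => [|k IHk] kp; first by lia.
move=> lt; rewrite -(expn1 p); apply: dvdn_acoefS => //; rewrite expn1.
have [lt'|le] := ltnP p (6 * k); first by rewrite dvdn_mull // IHk // ltnW.
rewrite dvdn_mulr //.
have [e|e] := prime_mod6 _ pp (ltnW (ltnW p5)).
  by rewrite dvdn_mulr // (_ : 6 * k + 1 = p)%N //; lia.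
by rewrite dvdn_mull // (_ : 6 * k + 5 = p)%N //; lia.
Qed.

(** The recurrence also multiplies by 5p, as one of its factors 6j + 1 and
    6j + 5, after a_j has become divisible by p. *)
Lemma dvdn2_acoef k : (k < p)%N -> (5 * p < 6 * k)%N -> (p ^ 2 %| acoef k)%N.
Proof.
elim: k => [|k IHk] kp; first by lia.
move=> lt; apply: dvdn_acoefS => //.
have [lt'|le] := ltnP (5 * p) (6 * k); first by rewrite dvdn_mull // IHk // ltnW.
have pa : (p %| acoef k)%N by apply: dvdn_acoef; lia.
rewrite -mulnn dvdn_mul //.
have [e|e] := prime_mod6 _ pp (ltnW (ltnW p5)).
  by rewrite dvdn_mull // (_ : 6 * k + 5 = 5 * p)%N ?dvdn_mull //; lia.
by rewrite dvdn_mulr // (_ : 6 * k + 1 = 5 * p)%N ?dvdn_mull //; lia.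
Qed.

Lemma dvdn2_acoefM i j : (i < p)%N -> (j < p)%N -> (p <= i + j)%N ->
  (p ^ 2 %| acoef i * acoef j)%N.
Proof.
move=> ip jp ij; have p6 := prime_mod6 _ pp (ltnW (ltnW p5)).
have [lti|lei] := ltnP p (6 * i); have [ltj|lej] := ltnP p (6 * j).
- by rewrite -mulnn dvdn_mul // dvdn_acoef.
- by rewrite dvdn_mulr // dvdn2_acoef //; lia.
- by rewrite dvdn_mull // dvdn2_acoef //; lia.
- by lia.
Qed.

Lemma dvdn2_ccoef k : (k < p)%N -> (p < 2 * k)%N -> (p ^ 2 %| ccoef k)%N.
Proof.
move=> kp lt; rewrite ccoefE -mulnn dvdn_mul //; last by rewrite dvdn_acoef //; lia.
have co : coprime p (k`! * k`!).
  by rewrite coprimeMr andbb coprime_fact_lt_prime.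
rewrite -(Gauss_dvdl _ co).
have := @bin_fact (2 * k) k; rewrite (_ : 2 * k - k = k)%N; last by lia.
by move=> ->; [rewrite dvdn_fact //; lia | lia].
Qed.

(** Modulo 6n + 1 the parameter n is -1/6, and 432 n(n+1) becomes -60: the
    sequence a_k and the rescaled Legendre coefficients then satisfy the same
    recurrence. *)
Lemma acoef_legendre n k : (p ^ 2 %| 6 * n + 1)%N -> (k < p)%N ->
  ((p ^ 2)%:Z %| (acoef k)%:R - 432 ^+ k * legendre_coef n k)%Z.
Proof.
move=> Hn; elim: k => [|k IHk] kp.
  by rewrite /legendre_coef /acoef !muln0 !bin0 mulr1 subrr dvdz0.
have co : coprimez (p ^ 2)%:Z (k.+1%:R ^+ 2).
  by rewrite coprimezXr // natz; apply: coprimeXl; apply: coprime_lt_prime.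
rewrite -(Gauss_dvdzr _ co) mulrBr.
have -> : (k.+1%:R ^+ 2 : int) * (acoef k.+1)%:R =
   12 * ((6 * k%:R + 1) * (6 * k%:R + 5)) * (acoef k)%:R.
  by rewrite -natrX -natrM acoefS !(natrM, natrD).
have -> : (k.+1%:R ^+ 2 : int) * (432 ^+ k.+1 * legendre_coef n k.+1) =
   432 ^+ k.+1 * ((k%:R * k.+1%:R - n%:R * n.+1%:R) * legendre_coef n k).
  by rewrite mulrCA legendre_coefS.
rewrite exprS.
have -> : 12 * ((6 * k%:R + 1) * (6 * k%:R + 5)) * (acoef k)%:R -
     432 * 432 ^+ k * ((k%:R * k.+1%:R - n%:R * n.+1%:R) * legendre_coef n k)
   = 12 * ((6 * k%:R + 1) * (6 * k%:R + 5)) * ((acoef k)%:R - 432 ^+ k * legendre_coef n k)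
   + 12 * (6 * n%:R + 5) * (432 ^+ k * legendre_coef n k) * (6 * n%:R + 1) :> int.
  ring.
apply: rpredD; first by rewrite dvdz_mull // IHk // ltnW.
rewrite dvdz_mull // (_ : 6 * n%:R + 1 = (6 * n + 1)%N%:Z) //.
by rewrite -natz natrD natrM.
Qed.

End Valuations.

(** * Clausen's formula modulo the square of a prime *)

Lemma poly_comp_sum n (E : nat -> int) (q : {poly int}) :
  (\poly_(k < n) E k) \Po q = \sum_(k < n) E k *: q ^+ k.
Proof.
rewrite poly_def raddf_sum /=; apply: eq_bigr => k _.
by rewrite comp_polyZ rmorphXn /= comp_polyX.
Qed.

Lemma legendre_sqr_scaled n :
  (\poly_(k < n.+1) (432 ^+ k * legendre_coef n k)) ^+ 2 =
  \sum_(k < n.+1) (432 ^+ k * legendre_coef n k * 'C(2 * k, k)%:R) *: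
     ('X * (1 - 432 * 'X)) ^+ k.
Proof.
have cst : 432 * 'X = (432 : int) *: 'X :> {poly int} by rewrite scaler_nat mulr_natl.
transitivity ((\poly_(k < n.+1) legendre_coef n k) ^+ 2 \Po (432 * 'X)).
  rewrite rmorphXn /= poly_comp_sum poly_def; congr (_ ^+ 2).
  by apply: eq_bigr => k _; rewrite cst exprZn scalerA mulrC.
rewrite legendre_sqr -comp_polyA poly_comp_sum; apply: eq_bigr => k _.
have -> : ('X * (1 - 'X)) \Po (432 * 'X) = (432 : int) *: ('X * (1 - 432 * 'X)).
  rewrite comp_polyM comp_polyB comp_polyX rmorph1 cst; rewrite scalerAl; ring.
by rewrite exprZn scalerA; congr (_ *: _); ring.
Qed.

Lemma coef_clausen_pow_lt k j : (j < k)%N ->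
  (('X * (1 - 432 * 'X)) ^+ k : {poly int})`_j = 0.
Proof. by move=> lt; rewrite exprMn coefXnM lt. Qed.

Lemma coef_clausen_pow_gt k j : (2 * k < j)%N ->
  (('X * (1 - 432 * 'X)) ^+ k : {poly int})`_j = 0.
Proof.
move=> lt; apply/leq_sizeP: (leqnn j).
apply: leq_trans (size_poly_exp_leq _ _) _.
have -> : size ('X * (1 - 432 * 'X) : {poly int}) = 3%N.
  have -> : 'X * (1 - 432 * 'X) = Poly [:: 0; 1; -432] :> {poly int}.
    rewrite /= !cons_poly_def; ring.
  by rewrite (PolyK (c := 0)).
by rewrite /=; lia.
Qed.

Section ModP2.
Variables (p : nat) (pp : prime p) (p5 : (5 < p)%N).

Lemma dvdz_sum (I : Type) (r : seq I) (P : pred I) (F : I -> int) (d : int) :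
  (forall i, P i -> (d %| F i)%Z) -> (d %| \sum_(i <- r | P i) F i)%Z.
Proof. by move=> H; apply: rpred_sum. Qed.

(** In degree below p, the polynomial identity for Legendre polynomials of
    degree n = (p^2 - 1)/6, with X rescaled by 432, is the claim modulo p^2; in degree at least p, each
    term is separately divisible by p^2. *)
Lemma dvdz_clausen_coef j :
  ((p ^ 2)%:Z %| (\sum_(k < p) (ccoef k)%:R *: ('X * (1 - 432 * 'X)) ^+ k
    - (\poly_(k < p) (acoef k)%:R) ^+ 2 : {poly int})`_j)%Z.
Proof.
set T := 'X * (1 - 432 * 'X); set A := \poly_(k < p) _.
have [jp|pj] := ltnP j p; last first.
  rewrite coefB coef_sum; apply: rpredB.
    apply: dvdz_sum => k _; rewrite coefZ.
    have [lt|le] := ltnP (2 * k) j; first by rewrite coef_clausen_pow_gt // mulr0 dvdz0.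
    have kp := ltn_ord k.
    have p2 : (2 %| p)%N = false by rewrite dvdn_prime2 //; lia.
    by rewrite dvdz_mulr // natz; apply: dvdn2_ccoef => //; lia.
  rewrite expr2 coefM; apply: dvdz_sum => i _; rewrite !coef_poly.
  case: ltnP => ip; last by rewrite mul0r dvdz0.
  case: ltnP => ip'; last by rewrite mulr0 dvdz0.
  rewrite -natrM natz; apply: dvdn2_acoefM => //; have := ltn_ord i; lia.
pose n := (p ^ 2 %/ 6)%N.
have nE : (6 * n + 1 = p ^ 2)%N.
  have p6 : (p ^ 2 %% 6 = 1)%N.
    by rewrite -modnXm; case: (prime_mod6 _ pp (ltnW (ltnW p5))) => ->.
  rewrite /n [RHS](divn_eq _ 6) p6; lia.
have pn : (p <= n)%N by rewrite expnS expn1 in nE; nia.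
have dvn : (p ^ 2 %| 6 * n + 1)%N by rewrite nE.
have cong k : (k < p)%N -> ((p ^ 2)%:Z %| (acoef k)%:R - 432 ^+ k * legendre_coef n k)%Z.
  exact: acoef_legendre.
pose Y : {poly int} := \poly_(k < n.+1) (432 ^+ k * legendre_coef n k).
pose Cn : {poly int} :=
  \sum_(k < n.+1) (432 ^+ k * legendre_coef n k * 'C(2 * k, k)%:R) *: T ^+ k.
set C : {poly int} := \sum_(k < p) _.
have YC : Y ^+ 2 = Cn by apply: legendre_sqr_scaled.
have -> : C - A ^+ 2 = (C - Cn) - (A ^+ 2 - Y ^+ 2) by rewrite YC; ring.
rewrite coefB; apply: rpredB.
  rewrite coefB.
  have -> : Cn`_j =
      (\sum_(k < p) (432 ^+ k * legendre_coef n k * 'C(2 * k, k)%:R) *: T ^+ k)`_j.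
    rewrite /Cn !coef_sum.
    pose G k := ((432 ^+ k * legendre_coef n k * 'C(2 * k, k)%:R) *: T ^+ k)`_j.
    rewrite (big_ord_widen _ G (leqW pn)) /G.
    rewrite [RHS]big_mkcond /=; apply: eq_bigr => k _.
    case: ltnP => // pk; rewrite coefZ coef_clausen_pow_lt ?mulr0 //; lia.
  rewrite /C !coef_sum -sumrB; apply: dvdz_sum => k _.
  rewrite !coefZ -mulrBl; apply: dvdz_mulr.
  rewrite ccoefE natrM mulrC -mulrBl; apply: dvdz_mulr; exact: cong.
rewrite (_ : A ^+ 2 - Y ^+ 2 = (A - Y) * (A + Y)); last by ring.
rewrite coefM; apply: dvdz_sum => i _; apply: dvdz_mulr.
have ip : (i < p)%N by have := ltn_ord i; lia.
rewrite coefB !coef_poly ip (leq_trans ip) ?cong //; exact: leqW.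
Qed.

(** The rings of interest are fields of characteristic p and the matrices over
    Z/p^2. *)
Lemma clausen_mod_p2 (B : nzRingType) (x : B) : (p ^ 2)%:R = 0 :> B ->
  \sum_(k < p) (ccoef k)%:R * (x * (1 - 432 * x)) ^+ k =
  (\sum_(k < p) (acoef k)%:R * x ^+ k) ^+ 2.
Proof.
move=> B0.
have [phi phiX] : exists phi : {rmorphism {poly int} -> B}, phi 'X = x.
  have cx : commr_rmorph (intmul (1 : B)) x by move=> z; apply: commr_int.
  by exists (horner_morph cx); apply: horner_morphX.
pose U : {poly int} := \sum_(k < p) (ccoef k)%:R *: ('X * (1 - 432 * 'X)) ^+ k.
pose V : {poly int} := \poly_(k < p) (acoef k)%:R.
have phiZ (c : nat) q : phi (c%:R *: q) = c%:R * phi q.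
  by rewrite scaler_nat rmorphMn /= mulr_natl.
have phiT : phi ('X * (1 - 432 * 'X)) = x * (1 - 432 * x).
  by rewrite rmorphM rmorphB rmorphM phiX rmorph1 rmorph_nat.
have D0 : phi (U - V * V) = 0.
  have -> : U - V * V = (p ^ 2)%:R *: map_poly (fun z => (z %/ (p ^ 2)%:Z)%Z) (U - V * V).
    apply/polyP => j; rewrite coefZ coef_map_id0 ?div0z // natz [RHS]mulrC divzK //.
    by rewrite -expr2; apply: dvdz_clausen_coef.
  by rewrite phiZ B0 mul0r.
have phiU : phi U = \sum_(k < p) (ccoef k)%:R * (x * (1 - 432 * x)) ^+ k.
  by rewrite rmorph_sum; apply: eq_bigr => k _; rewrite phiZ rmorphXn /= phiT.
have phiV : phi V = \sum_(k < p) (acoef k)%:R * x ^+ k.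
  by rewrite /V poly_def rmorph_sum; apply: eq_bigr => k _; rewrite phiZ rmorphXn /= phiX.
apply/eqP; rewrite -subr_eq0 -phiU -phiV expr2 -rmorphM -rmorphB; exact/eqP.
Qed.

End ModP2.

(** * The quadratic character of a finite field *)

Definition qchar (F : finFieldType) (x : F) : int :=
  if x == 0 then 0 else if [exists y : F, y ^+ 2 == x] then 1 else -1.

Section QuadraticCharacter.
Variables (F : finFieldType) (oddF : odd #|F|).
Local Notation n := (#|F|.-1).
Local Notation chi := (@qchar F).

Lemma card_predK : n.+1 = #|F|.
Proof. by rewrite prednK // ltnW // finNzRing_gt1. Qed.

Lemma expf_pred (x : F) : x != 0 -> x ^+ n = 1.
Proof.
move=> x0; apply: (mulfI x0); rewrite -exprS card_predK mulr1; exact: expf_card.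
Qed.

Lemma generator_exists : exists g : F, n.-primitive_root g.
Proof.
have n0 : (0 < n)%N by rewrite -ltnS card_predK finNzRing_gt1.
have : has n.-primitive_root (enum (predC1 (0 : F))).
  apply: has_prim_root => //; last 2 first.
  - exact: enum_uniq.
  - by rewrite -cardE cardC1.
  apply/allP => x; rewrite mem_enum inE /= unity_rootE => x0.
  by rewrite expf_pred.
by case/hasP => g _ gP; exists g.
Qed.

Lemma generatorP (g : F) : n.-primitive_root g ->
  forall x, x != 0 -> exists i : nat, x = g ^+ i.
Proof.
move=> gP x x0; have [i ->] := prim_rootP gP (expf_pred x x0); by exists i.
Qed.

Lemma even_pred_card : ~~ odd n.
Proof. by move: oddF; rewrite -card_predK. Qed.

Lemma generator_neq0 (g : F) : n.-primitive_root g -> g != 0.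
Proof.
move=> gP; apply/eqP => g0; have := prim_expr_order gP.
rewrite g0 expr0n; case: eqP => [|_ /eqP]; last by rewrite eq_sym oner_eq0.
by move=> n0; have := finNzRing_gt1 F; rewrite -card_predK n0.
Qed.

Lemma qchar0 : chi 0 = 0.
Proof. by rewrite /qchar eqxx. Qed.

Lemma qchar_gen (g : F) i : n.-primitive_root g -> chi (g ^+ i) = (-1) ^+ i.
Proof.
move=> gP; have g0 := generator_neq0 g gP.
rewrite /qchar expf_eq0 (negPf g0) andbF -signr_odd.
case: existsP => [[y /eqP yE]|H]; last first.
  case oi : (odd i) => //; case: H; exists (g ^+ i./2).
  by rewrite -exprM muln2 -[X in _ == _ ^+ X]odd_double_half oi.
have y0 : y != 0.
  by apply/eqP => y0; move/eqP: yE; rewrite y0 expr0n eq_sym expf_eq0 (negPf g0) andbF.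
have [j yj] := generatorP g gP y y0.
move/eqP: yE; rewrite yj -exprM (eq_prim_root_expr gP) => /eqP/(congr1 odd).
have on : odd n = false by apply/negbTE; exact: even_pred_card.
by rewrite !odd_mod // oddM andbF => <-.
Qed.

Lemma qcharM : {morph chi : x y / x * y}.
Proof.
move=> x y; have [->|x0] := eqVneq x 0; first by rewrite mul0r qchar0 mul0r.
have [->|y0] := eqVneq y 0; first by rewrite mulr0 qchar0 mulr0.
have [g gP] := generator_exists.
have [i ->] := generatorP g gP x x0; have [j ->] := generatorP g gP y y0.
by rewrite -exprD !(qchar_gen g) // exprD.
Qed.

Lemma qchar_sqr x : x != 0 -> chi x ^+ 2 = 1.
Proof.
have [g gP] := generator_exists.
by move=> /(generatorP g gP)[i ->]; rewrite (qchar_gen g) // sqrr_sign.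
Qed.

Lemma qchar_expr2 x : x != 0 -> chi (x ^+ 2) = 1.
Proof. by move=> x0; rewrite expr2 qcharM -expr2 qchar_sqr. Qed.

Lemma qchar1 : chi 1 = 1.
Proof. by rewrite -(expr1n F 2) qchar_expr2 // oner_eq0. Qed.

Lemma generator_half (g : F) : n.-primitive_root g -> g ^+ n./2 = -1.
Proof.
move=> gP; have n0 := prim_order_gt0 gP.
have nE : (n./2 * 2 = n)%N.
  by rewrite muln2 -[RHS]odd_double_half (negPf even_pred_card).
have : (g ^+ n./2) ^+ 2 == 1 by rewrite -exprM nE prim_expr_order.
rewrite sqrf_eq1 => /orP[|/eqP//]; rewrite -(prim_order_dvd gP) => /dvdn_leq; lia.
Qed.

Lemma two_neq0 : 2 != 0 :> F.
Proof.
have [g gP] := generator_exists; apply/eqP => e.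
have : g ^+ n./2 = 1.
  by rewrite generator_half //; apply/eqP; rewrite eq_sym -subr_eq0 opprK -[1 + 1]/(2 : F) e.
move/eqP; rewrite -(prim_order_dvd gP) => /dvdn_leq.
have := even_pred_card; have := prim_order_gt0 gP; lia.
Qed.

Lemma euler_criterion x : (chi x)%:~R = x ^+ n./2.
Proof.
have [g gP] := generator_exists; have n0 := prim_order_gt0 gP.
have [->|x0] := eqVneq x 0.
  rewrite qchar0 expr0n; case: eqP => // e; have := even_pred_card; lia.
have [i ->] := generatorP g gP x x0.
by rewrite (qchar_gen g) // exprAC generator_half // rmorphXn /= rmorphN1.
Qed.

Lemma sum_scale (f : F -> int) (a : F) : a != 0 -> \sum_x f x = \sum_x f (a * x).
Proof. by move=> a0; apply: reindex_inj; apply: mulfI. Qed.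

Lemma sum_shift (f : F -> int) (a : F) : \sum_x f x = \sum_x f (x + a).
Proof. by apply: reindex_inj; apply: addIr. Qed.

Lemma sum_qchar : \sum_x chi x = 0.
Proof.
have [g gP] := generator_exists.
have g0 := generator_neq0 g gP.
have : \sum_x chi x = - \sum_x chi x.
  rewrite {1}(sum_scale _ g) // -sumrN; apply: eq_bigr => x _.
  by rewrite qcharM -[in chi g](expr1 g) (qchar_gen g) // mulN1r.
lia.
Qed.

(** Off zero, x(x + d) has the character of 1 + d/x, which takes every value
    but 1. *)
Lemma sum_qchar_mul_shift (d : F) : d != 0 -> \sum_x chi (x * (x + d)) = -1.
Proof.
move=> d0; rewrite (bigD1 0) //= mul0r qchar0 add0r.
transitivity (\sum_(x : F | x != 0) chi (1 + d * x^-1)).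
  apply: eq_bigr => x x0; rewrite -[RHS]mul1r -(qchar_expr2 x) // -qcharM.
  by congr chi; field.
transitivity (\sum_(x : F | x != 0) chi (1 + d * x)).
  rewrite [RHS](reindex_inj invr_inj) /=; apply: eq_bigl => x; by rewrite invr_eq0.
have : \sum_x chi (1 + d * x) = 0.
  transitivity (\sum_x chi x); last exact: sum_qchar.
  rewrite [RHS](sum_shift _ 1) [RHS](sum_scale _ d) //.
  by apply: eq_bigr => x _; rewrite addrC.
by rewrite (bigD1 0) //= mulr0 addr0 qchar1 => /eqP; rewrite addrC addr_eq0 => /eqP ->.
Qed.

Lemma card_sqrt (d : F) : (#|[pred y : F | y ^+ 2 == d]|)%:R = 1 + chi d.
Proof.
have [->|d0] := eqVneq d 0.
  rewrite qchar0 (eq_card (B := pred1 0)) ?card1 // => x.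
  by rewrite !inE expf_eq0.
rewrite /qchar (negPf d0); case: existsP => [[y /eqP yE]|H]; last first.
  rewrite (eq_card0 (A := [pred y | _])) // => x; rewrite !inE.
  by apply/negP => h; case: H; exists x.
rewrite (eq_card (B := pred2 y (- y))) => [|x]; last by rewrite !inE -yE eqf_sqr.
have ny : y != - y.
  rewrite -subr_eq0 opprK -mulr2n -mulr_natl mulf_neq0 ?two_neq0 //.
  by apply: contraNneq d0 => y0; rewrite -yE y0 expr0n.
by rewrite card2 ny.
Qed.

(** Off zero, the left summand is the character of x + b/x + a.  The value v is
    taken by x + b/x as often as v^2 - 4b has square roots, so grouping by v
    produces the character of (v + a)(v^2 - 4b). *)
Lemma sum_qchar_two_isogeny (a b : F) : b != 0 ->
  \sum_x chi (x * (x ^+ 2 + a * x + b)) =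
  \sum_x chi (x * (x ^+ 2 - 2 * a * x + (a ^+ 2 - 4 * b))).
Proof.
move=> b0; rewrite (bigD1 0) //= mul0r qchar0 add0r.
transitivity (\sum_(x : F | x != 0) chi (x + b / x + a)).
  apply: eq_bigr => x x0; rewrite -[RHS]mul1r -(qchar_expr2 x) // -qcharM.
  by congr chi; field.
transitivity (\sum_v chi (v + a) * (1 + chi (v ^+ 2 - 4 * b))).
  rewrite (partition_big (fun x => x + b / x) xpredT) //=; apply: eq_bigr => v _.
  rewrite -card_sqrt.
  transitivity (\sum_(x : F | (2 * x - v) ^+ 2 == v ^+ 2 - 4 * b) chi (v + a)).
    apply: eq_big => [x|x /andP[_ /eqP->] //].
    have -> : ((2 * x - v) ^+ 2 == v ^+ 2 - 4 * b) = (x ^+ 2 + b == v * x).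
      rewrite -subr_eq0 -[RHS]subr_eq0.
      have -> : (2 * x - v) ^+ 2 - (v ^+ 2 - 4 * b) = 2 ^+ 2 * (x ^+ 2 + b - v * x) by ring.
      by rewrite mulf_eq0 expf_eq0 (negPf two_neq0) andbF.
    have [->|x0] := eqVneq x 0.
      by rewrite expr0n /= mulr0 add0r (negPf b0).
    rewrite /= -(inj_eq (mulIf x0)) mulrDl divfK // expr2.
  rewrite sumr_const -[LHS]mulr_natr; congr (_ * _%:R).
  rewrite -(card_image (f := fun x => 2 * x - v)).
    apply: eq_card => y; rewrite !inE; apply/imageP/idP.
      by case=> x xP ->.
    move=> yP; exists ((y + v) / 2); last by field; rewrite two_neq0.
    rewrite ?inE ?unfold_in (_ : 2 * ((y + v) / 2) - v = y) //.
    by field; rewrite two_neq0.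
  by move=> x y /addIr/(mulfI two_neq0).
transitivity (\sum_v (chi (v + a) + chi ((v + a) * (v ^+ 2 - 4 * b)))).
  by apply: eq_bigr => v _; rewrite qcharM; ring.
rewrite big_split /= -(sum_shift chi a) sum_qchar add0r (sum_shift _ (- a)).
by apply: eq_bigr => v _; congr chi; ring.
Qed.

End QuadraticCharacter.

(** * Character sums of cubics *)

Lemma sum_period3 (h : nat -> int) r : (forall i, h i.+3 = h i) ->
  \sum_(0 <= i < r * 3) h i = r%:R * (h 0%N + h 1%N + h 2).
Proof.
move=> hp; have hr i k : h (k * 3 + i)%N = h i.
  by elim: k => // k IHk; rewrite mulSn -IHk -addnA; apply: hp.
elim: r => [|r IHr]; first by rewrite big_geq // mul0r.
rewrite (_ : r.+1 * 3 = (r * 3).+3)%N; last by lia.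
rewrite !big_nat_recr //= IHr -[(r * 3)%N]addn0 -!addnS !hr -natr1; ring.
Qed.

Lemma sum_indicator (T : finType) (P : pred T) :
  \sum_x (P x)%:R = #|[pred x | P x]|%:R :> int.
Proof.
rewrite -sum1_card natr_sum [RHS]big_mkcond /=; apply: eq_bigr => x _.
by rewrite inE; case: (P x).
Qed.

Section CubicSums.
Variables (F : finFieldType) (oddF : odd #|F|).
Local Notation n := (#|F|.-1).
Local Notation chi := (@qchar F).

Definition cubic_sum (c : F) : int := \sum_x chi (x ^+ 3 + c).

Lemma sum_neq0_generator (g : F) (f : F -> int) : n.-primitive_root g ->
  \sum_(x | x != 0) f x = \sum_(0 <= i < n) f (g ^+ i).
Proof.
move=> gP; rewrite -(big_map (fun i => g ^+ i) xpredT f).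
transitivity (\sum_(x <- enum (predC1 (0 : F))) f x); first by rewrite big_enum.
apply: perm_big; apply: uniq_perm.
- exact: enum_uniq.
- rewrite map_inj_in_uniq ?iota_uniq // => i j.
  rewrite !mem_index_iota => /andP[_ ilt] /andP[_ jlt].
  by move/eqP; rewrite (eq_prim_root_expr gP) !modn_small // => /eqP.
move=> x; rewrite mem_enum inE; apply/idP/mapP => [x0|[i _ ->]].
  have [i xE] := prim_rootP gP (expf_pred F x x0).
  by exists (val i); rewrite // mem_index_iota /=.
by rewrite expf_eq0 negb_and (generator_neq0 F g gP) orbT.
Qed.

(** For fixed x and y the sum over c is the character sum of a product of two
    linear forms, which only depends on whether they coincide. *)
Lemma cubic_sum_cross (x y : F) :
  \sum_c chi (x ^+ 3 + c) * chi (y ^+ 3 + c) = #|F|%:R * (y ^+ 3 == x ^+ 3)%:R - 1.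
Proof.
rewrite (sum_shift _ _ (- x ^+ 3)).
transitivity (\sum_c chi (c * (c + (y ^+ 3 - x ^+ 3)))).
  by apply: eq_bigr => c _; rewrite -qcharM //; congr chi; ring.
have [e|ne] := eqVneq (y ^+ 3) (x ^+ 3); last first.
  by rewrite sum_qchar_mul_shift ?subr_eq0 // mulr0 add0r.
rewrite e subrr (bigD1 0) //= mul0r qchar0 add0r mulr1.
transitivity (\sum_(c : F | c != 0) (1 : int)).
  by apply: eq_bigr => c c0; rewrite addr0 -expr2 qchar_expr2.
rewrite sumr_const cardC1 -card_predK -[n.+1%:R]natr1 addrK; ring.
Qed.

Lemma cubic_sum_scale (g c : F) : g != 0 -> cubic_sum (c * g ^+ 3) = chi g * cubic_sum c.
Proof.
move=> g0; rewrite /cubic_sum (sum_scale _ _ g) // mulr_sumr; apply: eq_bigr => x _.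
rewrite -qcharM // -[RHS]mul1r -(qchar_expr2 F oddF g) // -qcharM //.
by congr chi; ring.
Qed.

Lemma cubic_sum_eq0 (c : F) : (n %% 3 = 1)%N -> cubic_sum c = 0.
Proof.
move=> n3; pose e := ((2 * n + 1) %/ 3)%N.
have eE : (3 * e = 1 + n * 2)%N by rewrite /e; lia.
have inj : injective (fun x : F => x ^+ 3).
  apply: (can_inj (g := fun x => x ^+ e)) => x; rewrite -exprM eE exprD exprM expr1.
  have [->|x0] := eqVneq x 0; first by rewrite mul0r.
  by rewrite expf_pred // expr1n mulr1.
transitivity (\sum_x chi (x + c)); last by rewrite -(sum_shift _ chi) sum_qchar.
by rewrite [RHS](reindex_inj inj).
Qed.

Hypothesis n3 : (3 %| n)%N.

Lemma card_cubes (y : F) : y != 0 -> #|[pred x : F | x ^+ 3 == y ^+ 3]| = 3%N.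
Proof.
move=> y0; have [g gP] := generator_exists F.
have n0 := prim_order_gt0 gP.
have [w [w3 w1]] : exists w : F, w ^+ 3 = 1 /\ w != 1.
  exists (g ^+ (n %/ 3)); split; first by rewrite -exprM divnK // prim_expr_order.
  rewrite -(prim_order_dvd gP); apply/negP => /dvdn_leq.
  have := divnK n3; lia.
have wq : w ^+ 2 + w + 1 = 0.
  apply/eqP; have : (w - 1) * (w ^+ 2 + w + 1) = w ^+ 3 - 1 by ring.
  by move/eqP; rewrite w3 subrr mulf_eq0 subr_eq0 (negPf w1).
have u : uniq [:: y; w * y; w ^+ 2 * y].
  have w0 : w != 0.
    by apply/eqP => w0; move/eqP: w3; rewrite w0 expr0n /= eq_sym oner_eq0.
  have w21 : w ^+ 2 != 1.
    by apply: contraNneq w1 => e; rewrite -w3 exprS e mulr1.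
  rewrite /= !inE negb_or -{1 3}[y]mul1r !(inj_eq (mulIf y0)) andbT.
  rewrite eq_sym w1 eq_sym w21 /= -{1}[w]mulr1 expr2 (inj_eq (mulfI w0)) eq_sym.
  exact: w1.
rewrite -[RHS]/(size [:: y; w * y; w ^+ 2 * y]) -(card_uniqP u).
apply: eq_card => x; rewrite !inE -subr_eq0.
have -> : x ^+ 3 - y ^+ 3 = (x - y) * ((x - w * y) * (x - w ^+ 2 * y)).
  have -> : (x - y) * ((x - w * y) * (x - w ^+ 2 * y)) =
    x ^+ 3 - w ^+ 3 * y ^+ 3 - x * y * (x - w * y) * (w ^+ 2 + w + 1).
    ring.
  by rewrite w3 wq; ring.
by rewrite !mulf_eq0 !subr_eq0.
Qed.

Lemma cubic_sum_sqr : \sum_c cubic_sum c ^+ 2 = 2 * #|F|%:R * (#|F|%:R - 1).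
Proof.
transitivity (\sum_(x : F) \sum_(y : F) (#|F|%:R * (y ^+ 3 == x ^+ 3)%:R - 1 : int)).
  under eq_bigr => c _ do rewrite expr2 /cubic_sum mulr_suml.
  rewrite exchange_big; apply: eq_bigr => x _ /=.
  under eq_bigr => c _ do rewrite mulr_sumr.
  by rewrite exchange_big; apply: eq_bigr => y _; apply: cubic_sum_cross.
transitivity
  (\sum_(x : F) (#|F|%:R * #|[pred y : F | y ^+ 3 == x ^+ 3]|%:R - #|F|%:R : int)).
  apply: eq_bigr => x _; rewrite sumrB -mulr_sumr sumr_const; congr (_ * _ - _).
  exact: sum_indicator.
have e0 : #|[pred y : F | y ^+ 3 == 0 ^+ 3]| = 1%N.
  by rewrite -(card1 (0 : F)); apply: eq_card => x; rewrite !inE expr0n /= expf_eq0.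
rewrite (bigD1 0) //= e0.
rewrite (eq_bigr (fun=> 2 * #|F|%:R)) => [|x x0]; last by rewrite card_cubes //; ring.
by rewrite sumr_const cardC1 -mulr_natr -(card_predK F) -natr1; ring.
Qed.

Lemma cubic_sum_twisted : \sum_c chi c * cubic_sum c = 0.
Proof.
transitivity (\sum_(x : F) \sum_c chi (c * (c + x ^+ 3))).
  rewrite exchange_big; apply: eq_bigr => c _ /=; rewrite mulr_sumr.
  by apply: eq_bigr => x _; rewrite -qcharM // [c + _]addrC.
have e0 : \sum_c chi (c * (c + 0 ^+ 3)) = n%:R.
  rewrite expr0n /= (bigD1 0) //= mul0r qchar0 add0r.
  rewrite (eq_bigr (fun=> 1)) => [|c c0]; last by rewrite addr0 -expr2 qchar_expr2.
  by rewrite sumr_const cardC1.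
rewrite (bigD1 0) //= e0 (eq_bigr (fun=> -1)) => [|x x0]; last first.
  by rewrite sum_qchar_mul_shift // expf_eq0.
by rewrite sumr_const cardC1 mulNrn subrr.
Qed.

Lemma cubic_sum0 : cubic_sum 0 = 0.
Proof.
rewrite /cubic_sum -[RHS](sum_qchar F oddF); apply: eq_bigr => x _; rewrite addr0.
have [->|x0] := eqVneq x 0; first by rewrite expr0n.
by rewrite exprS qcharM // qchar_expr2 // mulr1.
Qed.

(** Every summand is odd, except for the three roots of x^3 = -1, and the
    number of elements of F is odd. *)
Lemma cubic_sum_even : exists A : int, cubic_sum 1 = 2 * A.
Proof.
suff /dvdzP[A AE] : (2 %| (cubic_sum 1)%R)%Z by exists A; rewrite AE mulrC.
have N1 : -1 != 0 :> F by rewrite oppr_eq0 oner_eq0.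
have N3 : (-1) ^+ 3 = -1 :> F by ring.
have : (2 %| (\sum_(x : F) (chi (x ^+ 3 + 1) + 1 - (x ^+ 3 == (-1) ^+ 3)%:R))%R)%Z.
  apply: rpred_sum => x _; rewrite /qchar addr_eq0 N3.
  by case: eqP => // _; case: ifP.
rewrite sumrB big_split /= -/(cubic_sum 1) sumr_const.
have -> : \sum_(x : F) (x ^+ 3 == (-1) ^+ 3)%:R = 3 :> int.
  by rewrite sum_indicator card_cubes.
rewrite natz; move: (cubic_sum 1) #|F| oddF => s q; lia.
Qed.

(** For a generator g, the sum of X^3 + c depends up to sign on c modulo cubes,
    so only the values a, b, d at 1, g, g^2 matter.  Orthogonality of the
    character with the sums gives a - b + d = 0 and the second moment gives
    a^2 + b^2 + d^2 = 6q; hence a^2 - ab + b^2 = 3q, and a = 2A makes the left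
    side 3A^2 + (b - A)^2. *)
Lemma cubic_sum_form : exists A B : int,
  cubic_sum 1 = 2 * A /\ #|F|%:R = A ^+ 2 + 3 * B ^+ 2.
Proof.
have [g gP] := generator_exists F; have g0 := generator_neq0 F g gP.
have n0 := prim_order_gt0 gP.
pose r := (n %/ 3)%N; have nE : n = (r * 3)%N by rewrite /r divnK.
have qE : #|F|%:R = 3 * r%:R + 1 :> int by rewrite -(card_predK F) nE -natr1 natrM; ring.
have r0 : r%:R != 0 :> int by rewrite pnatr_eq0; lia.
have chig : chi g = -1 by rewrite -[in LHS](expr1 g) (qchar_gen F oddF g) // expr1.
pose b := cubic_sum g; pose d := cubic_sum (g ^+ 2); pose a := cubic_sum 1.
have per c : cubic_sum (c * g ^+ 3) = - cubic_sum c by rewrite cubic_sum_scale // chig mulN1r.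
have lin : a - b + d = 0.
  apply: (mulfI r0); rewrite mulr0 -[RHS]cubic_sum_twisted (bigD1 0) //= qchar0 mul0r add0r.
  rewrite (sum_neq0_generator g) // nE sum_period3 => [|i].
    rewrite expr0 expr1 qchar1 // qchar_expr2 // chig -/a -/b -/d; ring.
  rewrite -addn3 exprD per qcharM // -[g ^+ 3]/(g * g ^+ 2).
  rewrite qcharM // qchar_expr2 // chig; ring.
have quad : a ^+ 2 + b ^+ 2 + d ^+ 2 = 6 * #|F|%:R.
  apply: (mulfI r0).
  transitivity (2 * #|F|%:R * (#|F|%:R - 1) : int); last by rewrite qE; ring.
  rewrite -cubic_sum_sqr (bigD1 0) //= cubic_sum0 expr0n add0r.
  rewrite (sum_neq0_generator g) // nE sum_period3 => [|i].
    by rewrite expr0 expr1.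
  by rewrite -addn3 exprD per sqrrN.
have [A aE] := cubic_sum_even.
have d3 : (3 %| (b - A) ^+ 2)%Z.
  apply/dvdzP; exists (#|F|%:R - A ^+ 2).
  have dE : d = b - a by lia.
  by move: quad; rewrite dE /a aE => quad; apply: (@mulfI _ 2) => //; lia.
have /dvdzP[B BE] : (3 %| b - A)%Z.
  by move: d3; rewrite !dvdzE abszX Euclid_dvdX // => /andP[].
exists A, B; split=> //.
move: quad; rewrite (_ : d = b - a) /a; last by lia.
rewrite aE (_ : b = B * 3 + A); last by lia.
move=> h; apply: (@mulfI _ 6) => //; rewrite -h; ring.
Qed.

End CubicSums.

(** Composing the two representations gives
    p^2 = (AC + 3BD)^2 + 3(AD - BC)^2 and the same with B replaced by - B.  As p
    divides (AD)^2 - (BC)^2 = p (D^2 - B^2), it divides AD - BC or AD + BC, and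
    the number that it divides is zero. *)
Lemma prime_form_uniq (p : nat) (A B C D : int) : prime p ->
  p%:Z = A ^+ 2 + 3 * B ^+ 2 -> p%:Z = C ^+ 2 + 3 * D ^+ 2 -> A ^+ 2 = C ^+ 2.
Proof.
move=> pp E1 E2; have p0 : p%:Z != 0 by have := prime_gt0 pp; lia.
(* a nonzero multiple of p has a square above p ^ 2 / 3 *)
have small u v : p%:Z ^+ 2 = v ^+ 2 + 3 * u ^+ 2 -> (p%:Z %| u)%Z -> u = 0.
  move=> h /dvdzP[k kE]; have k0 : k = 0.
    apply/eqP; apply: contraTT isT => k0.
    have k1 : 1 <= k ^+ 2 by rewrite -gtz0_ge1 exprn_even_gt0.
    have p2 : 0 < p%:Z ^+ 2 by rewrite exprn_even_gt0.
    have v0 : 0 <= v ^+ 2 by apply: sqr_ge0.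
    move: h; rewrite kE exprMn.
    move: (_ ^+ 2) (k ^+ 2) (v ^+ 2) k1 p2 v0 => P K V K1 P0 V0.
    by have : P <= K * P; [rewrite ler_peMl // ltW | lia].
  by rewrite kE k0 mul0r.
have AD : (A * D) ^+ 2 = (B * C) ^+ 2.
  have : (p%:Z %| (A * D - B * C) * (A * D + B * C))%Z.
    apply/dvdzP; exists (D ^+ 2 - B ^+ 2).
    transitivity (p%:Z * D ^+ 2 - p%:Z * B ^+ 2); last by ring.
    rewrite {1}E1 E2; ring.
  rewrite dvdzE abszM Euclid_dvdM // => /orP[] h.
    have q : p%:Z ^+ 2 = (A * C + 3 * (B * D)) ^+ 2 + 3 * (A * D - B * C) ^+ 2.
      by rewrite expr2 {1}E1 E2; ring.
    by move/eqP: (small _ _ q h); rewrite subr_eq0 => /eqP->.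
  have q : p%:Z ^+ 2 = (A * C - 3 * (B * D)) ^+ 2 + 3 * (A * D + B * C) ^+ 2.
    by rewrite expr2 {1}E1 E2; ring.
  by move/eqP: (small _ _ q h); rewrite addr_eq0 => /eqP->; rewrite sqrrN.
apply: (mulfI p0); rewrite {1}E2 E1.
transitivity (A ^+ 2 * C ^+ 2 + 3 * (A * D) ^+ 2); first by ring.
rewrite AD; ring.
Qed.

(** X^3 - 15X + 22 has the root 2; the isogenous cubic with respect to this
    root is (X - 4)^3 + 64, and 64 is both a cube and a square. *)
Lemma sum_qchar_cm12 (F : finFieldType) : odd #|F| -> 3 != 0 :> F ->
  \sum_(x : F) qchar F (x ^+ 3 - 15 * x + 22) = cubic_sum F 1.
Proof.
move=> oddF F3; have F2 := two_neq0 F oddF.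
rewrite (sum_shift _ _ 2).
transitivity (\sum_(x : F) qchar F (x * (x ^+ 2 + 6 * x + - 3))).
  by apply: eq_bigr => x _; congr (qchar F _); ring.
rewrite sum_qchar_two_isogeny ?oppr_eq0 // (sum_shift _ _ 4).
have F4 : 4 != 0 :> F by rewrite (_ : 4 = 2 * 2) ?mulf_neq0 //; ring.
rewrite (sum_scale _ _ 4) //; apply: eq_bigr => x _.
rewrite -[RHS]mul1r -(qchar_expr2 F oddF (8 : F)); last first.
  by rewrite (_ : 8 = 2 * 4) ?mulf_neq0 //; ring.
by rewrite -qcharM //; congr (qchar F _); ring.
Qed.

(** * Coefficients of powers of cubics as character sums *)

Lemma sum_expf (F : finFieldType) j : (j < 2 * #|F|.-1)%N ->
  \sum_(x : F) x ^+ j = - (j == #|F|.-1)%:R.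
Proof.
have [g gP] := generator_exists F; set n := #|F|.-1 in gP *.
have n0 := prim_order_gt0 gP.
have q0 : #|F|%:R = 0 :> F.
  have : \sum_(x : F) x = \sum_(x : F) (x + 1) by apply: reindex_inj; apply: addIr.
  rewrite big_split /= sumr_const => e; apply/eqP.
  by rewrite -(inj_eq (addrI (\sum_(x : F) x))) -e addr0.
case: j => [|j] jn.
  by rewrite sumr_const cardT -cardE q0 eq_sym eqn0Ngt n0 oppr0.
rewrite (bigD1 0) //= expr0n add0r.
have [->|jne] := eqVneq j.+1 n.
  rewrite (eq_bigr (fun=> 1)) => [|x x0]; last exact: expf_pred.
  apply/eqP; rewrite sumr_const cardC1 -subr_eq0 opprK -/n natr1 card_predK q0 //.
apply/eqP; rewrite oppr0; set s := \sum_(_ | _) _.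
have g0 := generator_neq0 F g gP.
have e : s = g ^+ j.+1 * s.
  rewrite /s mulr_sumr [LHS](reindex_inj (mulfI g0)) /=.
  apply: eq_big => [x|x _]; last by rewrite exprMn.
  by rewrite mulf_eq0 (negPf g0).
have : (1 - g ^+ j.+1) * s == 0 by rewrite mulrBl mul1r -e subrr.
rewrite mulf_eq0 subr_eq0 eq_sym -(prim_order_dvd gP) => /orP[|//].
move=> /dvdnP[k kE]; move: jn jne; rewrite kE.
case: k kE => [|[|k]]; [by [] | by rewrite mul1n eqxx | lia].
Qed.

Section CoefficientAsSum.
Variables (F : finFieldType) (L : fieldType) (iota : {rmorphism F -> L}).
Local Notation n := (#|F|.-1).

Lemma coef_as_sum (f : {poly L}) : (size f <= 2 * n)%N ->
  \sum_(x : F) f.[iota x] = - f`_n.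
Proof.
move=> sf.
under eq_bigr => x _ do rewrite (horner_coef_wide _ sf).
rewrite exchange_big /=.
have inner (j : 'I_(2 * n)) :
    \sum_(x : F) f`_j * iota x ^+ j = - (f`_j * (j == n :> nat)%:R).
  rewrite -mulr_sumr -mulrN; congr (_ * _).
  under eq_bigr => x _ do rewrite -rmorphXn.
  by rewrite -rmorph_sum sum_expf // rmorphN rmorph_nat.
under eq_bigr => j _ do rewrite inner.
have n0 : (0 < n)%N by rewrite -ltnS card_predK finNzRing_gt1.
have nn : (n < 2 * n)%N by lia.
rewrite sumrN (bigD1 (Ordinal nn)) //= eqxx mulr1 big1 ?addr0 // => j jn.
by rewrite (_ : (_ == _) = false) ?mulr0 //; apply/negbTE.
Qed.

(** Stated for shifts by elements of F: sums of values over F are invariant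
    under these. *)
Lemma coef_shift (f : {poly L}) (c : F) : (size f <= 2 * n)%N ->
  (f \Po ('X + (iota c)%:P))`_n = f`_n.
Proof.
move=> sf; apply: oppr_inj; rewrite -!coef_as_sum //; last first.
  by rewrite size_comp_poly2 // size_XaddC.
rewrite [RHS](reindex_inj (addIr c)) /=; apply: eq_bigr => x _.
by rewrite horner_comp !hornerE rmorphD.
Qed.

End CoefficientAsSum.

(** For 3k <= m, both sides are m! / (k! (2k)! (m - 3k)!). *)
Lemma bin_mul_bin m k : ('C(m, k) * 'C(m - k, 2 * k) = 'C(m, 3 * k) * 'C(3 * k, k))%N.
Proof.
have [le|lt] := leqP (3 * k) m; last first.
  by rewrite [X in (_ * X)%N]bin_small ?muln0 1?[X in (X * _)%N]bin_small //; lia.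
have f0 : (0 < k`! * (2 * k)`! * (m - 3 * k)`!)%N by rewrite !muln_gt0 !fact_gt0.
apply/eqP; rewrite -(eqn_pmul2r f0); apply/eqP.
have e1 := @bin_fact m k; have e2 := @bin_fact (m - k) (2 * k).
have e3 := @bin_fact m (3 * k); have e4 := @bin_fact (3 * k) k.
rewrite (_ : m - k - 2 * k = m - 3 * k)%N in e2; last by lia.
rewrite (_ : 3 * k - k = 2 * k)%N in e4; last by lia.
transitivity m`!.
  rewrite -e1; last by lia.
  rewrite -e2; last by lia.
  ring.
rewrite -e3; last by lia.
rewrite -e4; last by lia.
ring.
Qed.

Lemma coef_XaddC_exp (R : comNzRingType) (c : R) N j :
  (('X + c%:P) ^+ N)`_j = c ^+ (N - j) * 'C(N, j)%:R.
Proof.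
have [le|lt] := leqP j N; last first.
  rewrite bin_small // mulr0; apply/leq_sizeP: (leqnn j).
  apply: leq_trans (size_poly_exp_leq _ _) _; rewrite size_XaddC /=; lia.
rewrite addrC exprDn coef_sum (bigD1 (Ordinal (le : (j < N.+1)%N))) //= big1 ?addr0.
  by rewrite -polyC_exp coefMn coefCM coefXn eqxx mulr1 mulr_natr.
move=> i ij; rewrite -polyC_exp coefMn coefCM coefXn.
by rewrite (_ : (_ == _) = false) ?mulr0 ?mul0rn //; apply/negbTE; rewrite eq_sym.
Qed.

Lemma coef_nodal_cubic (R : comNzRingType) (v : R) m :
  (('X ^+ 2 * ('X + 3%:P) - v%:P) ^+ m)`_(2 * m) =
  \sum_(k < m.+1) 3 ^+ (m - 3 * k) * (- v) ^+ k * ('C(m, 3 * k) * 'C(3 * k, k))%:R.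
Proof.
rewrite exprDn coef_sum; apply: eq_bigr => k _.
have km : (k <= m)%N by rewrite -ltnS.
rewrite coefMn -polyCN -polyC_exp coefMC exprMn -exprM coefXnM.
rewrite (_ : (_ < _)%N = false); last by lia.
rewrite (_ : 2 * m - 2 * (m - k) = 2 * k)%N; last by lia.
rewrite coef_XaddC_exp (_ : m - k - 2 * k = m - 3 * k)%N; last by lia.
by rewrite -bin_mul_bin natrM -mulr_natr; ring.
Qed.

Lemma prime_half p : prime p -> (5 < p)%N -> p = (2 * p./2).+1.
Proof. by move=> pp p5; case: (even_prime pp); lia. Qed.

Section CharacteristicP.
Variables (p : nat) (pp : prime p) (p5 : (5 < p)%N).
Variables (L : fieldType) (pL : p \in [pchar L]).
Local Notation m := (p./2).
Local Notation odd_p := (prime_half p pp p5).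

Lemma natr_neq0_lt k : (0 < k < p)%N -> k%:R != 0 :> L.
Proof.
by move=> kp; rewrite -(dvdn_pcharf pL) -prime_coprime // coprime_lt_prime.
Qed.

Lemma central_bin_half j : (j < p)%N ->
  'C(m, j)%:R * (- 4) ^+ j = 'C(2 * j, j)%:R :> L.
Proof.
elim: j => [|j IHj] jp; first by rewrite !muln0 !bin0 mulr1.
apply: (mulfI (natr_neq0_lt j.+1 jp)); rewrite -[RHS]natrM mul_bin_central.
have e : j.+1%:R * 'C(m, j.+1)%:R = (m%:R - j%:R) * 'C(m, j)%:R :> L.
  have [le|lt] := leqP j m; last by rewrite !bin_small ?mulr0 // ltnW.
  by rewrite -natrB // -!natrM mul_bin_left.
rewrite exprS [LHS]mulrA e !natrM natrD natrM -IHj ?(ltnW jp) //.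
have p0 : 2 * m%:R + 1 = 0 :> L.
  by rewrite -natrM natr1 -odd_p; apply/eqP; rewrite -(dvdn_pcharf pL).
have -> : m%:R = - 2 ^-1 :> L.
  have F2 : 2 != 0 :> L by apply: natr_neq0_lt; lia.
  apply: (mulfI F2); rewrite mulrN divff //.
  by apply/eqP; rewrite -addr_eq0 p0.
field; apply: natr_neq0_lt; lia.
Qed.

(** In characteristic p = 2m + 1 the number m is -1/2, so that C(m, 3k) is
    C(6k, 3k) / (-64)^k. *)
Lemma coef_nodal_cubic_acoef (x : L) :
  (('X ^+ 2 * ('X + 3%:P) - (1728 * x)%:P) ^+ m)`_(2 * m) =
  3 ^+ m * \sum_(k < p) (acoef k)%:R * x ^+ k.
Proof.
rewrite coef_nodal_cubic mulr_sumr.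
have mp : (m.+1 <= p)%N by rewrite [in X in (_ <= X)%N]odd_p; lia.
rewrite (big_ord_widen _ (fun k => 3 ^+ (m - 3 * k) * (- (1728 * x)) ^+ k *
    ('C(m, 3 * k) * 'C(3 * k, k))%:R) mp).
rewrite big_mkcond /=; apply: eq_bigr => k _.
have [km|mk] := leqP (3 * k) m; last first.
  have -> : (acoef k)%:R = 0 :> L.
    apply/eqP; rewrite -(dvdn_pcharf pL) dvdn_acoef //.
    by rewrite [X in (X < _)%N]odd_p; lia.
  rewrite bin_small // mul0n mulr0 mul0r mulr0; by case: ifP.
rewrite ifT; last by lia.
rewrite /acoef !natrM (_ : 6 * k = 2 * (3 * k))%N; last by lia.
rewrite -central_bin_half; last by rewrite [X in (_ < X)%N]odd_p; lia.
have -> : 3 ^+ m = 3 ^+ (m - 3 * k) * (3 ^+ 3) ^+ k :> L by rewrite -exprM -exprD subnK.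
have -> : - (1728 * x) = (3 ^+ 3) * ((- 4) ^+ 3) * x by ring.
rewrite [(- 4) ^+ (3 * k)]exprM !exprMn; ring.
Qed.

End CharacteristicP.

(** * The truncated series in characteristic p *)

Lemma coef_comp_scale (R : comNzRingType) (f : {poly R}) (w : R) i :
  (f \Po (w *: 'X))`_i = w ^+ i * f`_i.
Proof.
rewrite comp_polyE coef_sum.
have [lt|le] := ltnP i (size f); last first.
  rewrite [f`_i]nth_default // mulr0 big1 // => j _.
  rewrite exprZn coefZ coefZ coefXn (_ : (_ == _) = false) ?mulr0 //.
  by apply/negbTE; rewrite neq_ltn (leq_trans (ltn_ord j) le) orbT.
rewrite (bigD1 (Ordinal lt)) //= big1 ?addr0 => [|j jn].
  by rewrite exprZn !coefZ coefXn eqxx mulr1 mulrC.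
rewrite exprZn !coefZ coefXn (_ : (_ == _) = false) ?mulr0 //.
by apply/negbTE; rewrite eq_sym.
Qed.

Lemma size_depressed_cubic (R : nzRingType) (b c : R) :
  size ('X ^+ 3 + b%:P * 'X + c%:P) = 4%N.
Proof.
have -> : 'X ^+ 3 + b%:P * 'X + c%:P = Poly [:: c; b; 0; 1].
  rewrite /= !cons_poly_def polyC1 polyC0 mul0r add0r mul1r addr0.
  by rewrite mulrDl -!expr2 -exprSr.
by rewrite (PolyK (c := 0)) //= oner_eq0.
Qed.

Lemma comp_depressed_cubic (R : comNzRingType) (b c : R) (q : {poly R}) :
  ('X ^+ 3 + b%:P * 'X + c%:P) \Po q = q ^+ 3 + b%:P * q + c%:P.
Proof. by rewrite !comp_polyD rmorphXn /= comp_polyM !comp_polyC comp_polyX. Qed.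

Lemma coef_cubic_exp (F : finFieldType) (L : fieldType)
    (iota : {rmorphism F -> L}) (b c : F) : odd #|F| ->
  (('X ^+ 3 + (iota b)%:P * 'X + (iota c)%:P) ^+ #|F|.-1./2)`_#|F|.-1 =
  - (\sum_(x : F) qchar F (x ^+ 3 + b * x + c))%:~R.
Proof.
move=> oddF; apply: oppr_inj; rewrite -(coef_as_sum F L iota); last first.
  apply: leq_trans (size_poly_exp_leq _ _) _; rewrite size_depressed_cubic /=.
  have n1 : (0 < #|F|.-1)%N by rewrite -ltnS card_predK finNzRing_gt1.
  by move: n1 (even_pred_card F oddF); move: (#|F|.-1) => n; lia.
rewrite opprK rmorph_sum /=; apply: eq_bigr => x _.
rewrite -(rmorph_int iota) euler_criterion // rmorphXn /= horner_exp.
by rewrite !hornerE !rmorphD rmorphXn rmorphM.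
Qed.

Section ModP.
Variables (p : nat) (pp : prime p) (p5 : (5 < p)%N).
Variables (L : fieldType) (iota : {rmorphism 'F_p -> L}).
Local Notation m := (p./2).
Local Notation pE := (prime_half p pp p5).

Lemma pchar_target : p \in [pchar L].
Proof. by rewrite inE pp -(rmorph_nat iota) (pcharf0 (pchar_Fp pp)) rmorph0 eqxx. Qed.
Local Notation pL := pchar_target.

Lemma card_Fp_pred : #|'F_p|.-1 = (2 * m)%N.
Proof. by rewrite card_Fp // [in LHS]pE. Qed.

Lemma half_bound : ((3 * m).+1 <= 2 * (2 * m))%N.
Proof. by have := p5; rewrite [X in (_ < X)%N -> _]pE; lia. Qed.

Lemma odd_card_Fp : odd #|'F_p|.
Proof. by rewrite card_Fp // pE /= mul2n odd_double. Qed.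

Let natr_neq0 k : (0 < k < p)%N -> k%:R != 0 :> L.
Proof. exact: (natr_neq0_lt p pp p5 L pL k). Qed.

Lemma coef_cm12_cubic :
  ((('X ^+ 3 + (- 15)%:P * 'X + 22%:P) ^+ m : {poly L})`_(2 * m)) =
  - (cubic_sum 'F_p 1)%:~R.
Proof.
have F3 : 3 != 0 :> 'F_p.
  by rewrite -(dvdn_pcharf (pchar_Fp pp)) dvdn_prime2 //; lia.
rewrite -sum_qchar_cm12 ?odd_card_Fp //.
transitivity (- (\sum_(x : 'F_p) qchar 'F_p (x ^+ 3 + (- 15) * x + 22))%:~R : L).
  rewrite -(coef_cubic_exp 'F_p L iota) ?odd_card_Fp // card_Fp_pred mul2n doubleK.
  have e15 : iota (- 15) = - 15 by rewrite rmorphN rmorph_nat.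
  have e22 : iota 22 = 22 by rewrite rmorph_nat.
  by rewrite e15 e22.
by congr (- _%:~R); apply: eq_bigr => x _; rewrite mulNr.
Qed.

(** The cubic X^3 - 3X + 2 - 1728x is the shift by 1 of X^2(X + 3) - 1728x,
    and the scaling of X by w turns it into (X^3 - 15X + 22) / w^3. *)
Lemma acoef_sum_cm12 (w x : L) : w ^+ 2 = 5 -> 25 * (864 * x) = 25 - 11 * w ->
  w ^+ m * 3 ^+ m * (\sum_(k < p) (acoef k)%:R * x ^+ k) = - (cubic_sum 'F_p 1)%:~R.
Proof.
move=> w2 xE; have F5 : 5 != 0 :> L by rewrite natr_neq0.
have w0 : w != 0 by apply: contraNneq F5 => w0; rewrite -w2 w0 expr0n.
pose g : {poly L} := 'X ^+ 3 + (- 3)%:P * 'X + (2 - 1728 * x)%:P.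
have sg : (size (g ^+ m) <= 2 * (2 * m))%N.
  apply: leq_trans (size_poly_exp_leq _ _) _; rewrite size_depressed_cubic /=.
  exact: half_bound.
rewrite -mulrA -(coef_nodal_cubic_acoef p pp p5 L pL).
have -> : 'X ^+ 2 * ('X + 3%:P) - (1728 * x)%:P = g \Po ('X + (iota 1)%:P).
  rewrite comp_depressed_cubic rmorph1; ring.
rewrite -rmorphXn /= -card_Fp_pred coef_shift card_Fp_pred //.
rewrite -coef_cm12_cubic.
have gw : ('X ^+ 3 + (- 15)%:P * 'X + 22%:P) \Po (w *: 'X) = w ^+ 3 *: g.
  rewrite comp_depressed_cubic /g.
  have c22 : 22 = w ^+ 3 * (2 - 1728 * x).
    have e25 : 25 * (1728 * x) = 50 - 22 * w.
      transitivity (2 * (25 * (864 * x))); first by ring.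
      rewrite xE; ring.
    apply: (mulfI (mulf_neq0 F5 F5)).
    transitivity (w * w ^+ 2 * (50 - 25 * (1728 * x))); last by ring.
    rewrite e25 w2; transitivity (110 * w ^+ 2); [rewrite w2; ring | ring].
  have c15 : 15 = 3 * w ^+ 2 by rewrite w2; ring.
  rewrite c22 c15 -!mul_polyC; ring.
have := congr1 (fun f : {poly L} => (f ^+ m)`_(2 * m)) gw.
rewrite /= -rmorphXn /= coef_comp_scale exprZn coefZ => e.
apply: (mulfI (expf_neq0 (2 * m) w0)); rewrite e mulrA -exprD; congr (_ * _).
by rewrite -exprM; rewrite -[3%N]/(2 + 1)%N mulnDl mul1n.
Qed.
End ModP.

(** * The Legendre symbol modulo 5 *)

Lemma legendre5E (p : nat) : ~~ (5 %| p)%N ->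
  legendre p 5 = if (p %% 5 \in [:: 1; 4])%N then 1 else -1.
Proof.
move=> n5; rewrite /legendre ifF; last by apply/negbTE.
have -> : [exists x : 'I_5, ((x%:Z ^+ 2)%R == p %[mod 5%:Z])%Z] =
    [exists x : 'I_5, (x ^ 2 %% 5 == p %% 5)%N].
  by apply: eq_existsb => x; rewrite -[(x%:Z ^+ 2)%R]/((x ^ 2)%N%:Z) !modz_nat.
have p5 : (p %% 5 < 5)%N by rewrite ltn_mod.
move: n5; rewrite /dvdn; move: (p %% 5)%N p5 => r r5 r0.
congr (if _ then _ else _); apply/existsP/idP => [[[x x5] /= /eqP xE]|].
  by move: r0 x5; rewrite -xE; case: x {xE} => [|[|[|[|[|]]]]].
rewrite !inE => /orP[] /eqP->; first by exists (inord 1); rewrite inordK.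
by exists (inord 2); rewrite inordK.
Qed.

(** The fifth root of unity supplies both the square root of 5 that the series
    needs and the Gauss sum that evaluates 5^((p-1)/2). *)
Lemma fifth_root_field (F : finFieldType) :
  exists (L : fieldType) (iota : {rmorphism F -> L}) (z : L),
    z ^+ 4 + z ^+ 3 + z ^+ 2 + z + 1 = 0.
Proof.
pose P : {poly F} := Poly [:: 1; 1; 1; 1; 1].
have PE : P = 'X ^+ 4 + 'X ^+ 3 + 'X ^+ 2 + 'X + 1.
  by rewrite /P /= !cons_poly_def polyC1; ring.
have sP : size P = 5%N by rewrite (PolyK (c := 0)) //= oner_eq0.
have P0 : P != 0 by rewrite -size_poly_eq0 sP.
have [L [rs Prs _]] := FinSplittingFieldFor P0.
have : size (map_poly (GRing.in_alg L) P) = 5%N by rewrite size_map_poly.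
rewrite (eqp_size Prs) size_prod_XsubC => - [srs].
case: rs srs Prs => // z rs _ Prs.
exists L, (GRing.in_alg L), z.
have : root (map_poly (GRing.in_alg L) P) z.
  by rewrite (eqp_root Prs) root_prod_XsubC mem_head.
rewrite rootE PE !rmorphD !rmorphXn /= map_polyX rmorph1.
by rewrite !hornerD !hornerXn hornerX hornerC => /eqP.
Qed.

Section GoldenField.
Variables (p : nat) (pp : prime p) (p5 : (5 < p)%N).
Variables (L : fieldType) (pL : p \in [pchar L]) (z : L).
Hypothesis z5 : z ^+ 4 + z ^+ 3 + z ^+ 2 + z + 1 = 0.

Definition gauss_sum5 : L := z + z ^+ 4 - z ^+ 2 - z ^+ 3.

Lemma gauss_sum5_sqr : gauss_sum5 ^+ 2 = 5.
Proof.
have -> : gauss_sum5 ^+ 2 = 5 + (z ^+ 4 + z ^+ 3 + z ^+ 2 + z + 1) *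
    (z ^+ 4 - 3 * z ^+ 3 + z ^+ 2 + 5 * z - 5) by rewrite /gauss_sum5; ring.
by rewrite z5 mul0r addr0.
Qed.

(** Frobenius raises z to the p-th power, hence permutes the four terms of the
    Gauss sum according to p modulo 5. *)
Lemma gauss_sum5_frobenius : gauss_sum5 ^+ p = (legendre p 5)%:~R * gauss_sum5.
Proof.
have z1 : z ^+ 5 = 1.
  apply/eqP; rewrite -subr_eq0; apply/eqP.
  transitivity ((z - 1) * (z ^+ 4 + z ^+ 3 + z ^+ 2 + z + 1)); first by ring.
  by rewrite z5 mulr0.
have n5 : ~~ (5 %| p)%N by rewrite dvdn_prime2 //; lia.
have zp k : (z ^+ k) ^+ p = z ^+ ((k * (p %% 5)) %% 5).
  by rewrite -exprM -(expr_mod _ z1) -modnMmr.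
have -> : gauss_sum5 ^+ p = z ^+ p + (z ^+ 4) ^+ p - (z ^+ 2) ^+ p - (z ^+ 3) ^+ p.
  by rewrite -!(pFrobenius_autE pL) /gauss_sum5 !rmorphB rmorphD.
rewrite -[z in z ^+ p](expr1 z) !zp legendre5E //.
have p5r : (p %% 5 < 5)%N by rewrite ltn_mod.
move: n5; rewrite /dvdn /gauss_sum5; move: (p %% 5)%N p5r => r r5 r0.
by case: r r0 r5 => [|[|[|[|[|r]]]]] //= _ _; rewrite ?expr1; ring.
Qed.

Lemma legendre5_euler : 5 ^+ p./2 = (legendre p 5)%:~R :> L.
Proof.
have w0 : gauss_sum5 != 0.
  apply/eqP => w0; have := natr_neq0_lt p pp p5 L pL 5 p5.
  by rewrite -gauss_sum5_sqr w0 expr0n eqxx.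
apply: (mulIf w0); rewrite -gauss_sum5_frobenius [in RHS](prime_half p pp p5).
by rewrite exprSr exprM gauss_sum5_sqr.
Qed.

End GoldenField.

(** * The congruences *)

Lemma p_integral_frac (p : nat) (n : int) (M : nat) : (0 < M)%N -> coprime M p ->
  p_integral p (n%:~R / M%:R).
Proof.
move=> M0 co; rewrite /p_integral; apply: coprime_dvdl co.
set x := n%:~R / M%:R.
have xM : x * M%:R = n%:~R by rewrite divfK // pnatr_eq0 -lt0n.
have e : numq x * M%:Z = n * denq x.
  apply: (@intr_inj rat); rewrite !rmorphM /= -xM [in LHS]numqE; ring.
have : (`|denq x| %| `|numq x| * M)%N.
  by rewrite -[M]/`|M%:Z|%N -abszM e abszM dvdn_mull.
by rewrite Gauss_dvdr // coprime_sym coprime_num_den.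
Qed.

Lemma rat_congr_frac (p m : nat) (n y : int) (M : nat) : (0 < M)%N -> coprime M p ->
  (m%:Z %| n - M%:R * y)%Z -> rat_congr p m (n%:~R / M%:R) y%:~R.
Proof.
move=> M0 co /dvdzP[q qE].
have M0' : M%:R != 0 :> rat by rewrite pnatr_eq0 -lt0n.
split; first exact: p_integral_frac.
  by rewrite -[y%:~R]divr1; apply: (p_integral_frac p y 1) => //; rewrite coprime1n.
exists (q%:~R / M%:R); first exact: p_integral_frac.
apply: (mulIf M0'); rewrite mulrBl divfK // mulrA divfK //.
have := congr1 (fun z : int => z%:~R : rat) qE.
rewrite /= rmorphB !rmorphM /= rmorph_nat => e; rewrite [RHS]mulrC -e; ring.
Qed.

(** Clearing the denominators of the sum of c_k / D^k by D^(p-1) keeps the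
    congruences between integers. *)
Definition ccoef_numer (D p : nat) : nat := \sum_(k < p) ccoef k * D ^ (p.-1 - k).

Lemma ccoef_numerE (D p : nat) (B : nzRingType) (e : B) : D%:R * e = 1 ->
  (ccoef_numer D p)%:R = (D ^ p.-1)%:R * \sum_(k < p) (ccoef k)%:R * e ^+ k.
Proof.
move=> De; have Dek k : (D ^ k)%:R * e ^+ k = 1.
  rewrite natrX -exprMn_comm ?De ?expr1n //; exact/commr_sym/commr_nat.
rewrite natr_sum mulr_sumr; apply: eq_bigr => k _.
have p0 : (0 < p)%N by apply: leq_ltn_trans (ltn_ord k).
have kp : (k <= p.-1)%N by rewrite -ltnS prednK ?ltn_ord.
transitivity ((ccoef k * D ^ (p.-1 - k))%:R * ((D ^ k)%:R * e ^+ k)).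
  by rewrite Dek mulr1.
rewrite [LHS]mulrA [RHS]mulrA -!natrM -[in RHS](subnK kp) expnD.
by rewrite -mulnA [in RHS]mulnC.
Qed.

Lemma denominator_gt0 : (0 < 54 * 10 ^ 3)%N.
Proof. by rewrite muln_gt0 expn_gt0. Qed.

Lemma ccoef_sum_frac (p : nat) :
  \sum_(0 <= k < p)
     ('C(2 * k, k) * 'C(3 * k, k) * 'C(6 * k, 3 * k))%N%:R / (54 * 10 ^+ 3) ^+ k
  = (ccoef_numer (54 * 10 ^ 3) p)%:~R / ((54 * 10 ^ 3) ^ p.-1)%:R :> rat.
Proof.
have D0 := denominator_gt0.
have -> : 54 * 10 ^+ 3 = (54 * 10 ^ 3)%N%:R :> rat by rewrite natrM natrX.
move: (54 * 10 ^ 3)%N D0 => D D0; have D0' : D%:R != 0 :> rat by rewrite pnatr_eq0 -lt0n.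
rewrite big_mkord -pmulrn (@ccoef_numerE D p _ D%:R^-1) ?divff //.
rewrite [(D ^ _)%:R * _]mulrC mulfK; last by rewrite pnatr_eq0 -lt0n expn_gt0 D0.
by apply: eq_bigr => k _; rewrite exprVn.
Qed.

Lemma coprime_denominator p : prime p -> (5 < p)%N -> coprime (54 * 10 ^ 3) p.
Proof.
move=> pp p5.
have co k : (0 < k < p)%N -> coprime k p.
  by move=> kp; rewrite coprime_sym (coprime_lt_prime p pp).
have c2 : coprime 2 p by rewrite co // (ltn_trans _ p5).
have c3 : coprime 3 p by rewrite co // (ltn_trans _ p5).
have c5 : coprime 5 p by rewrite co.
rewrite (_ : 54 = 2 * 3 ^ 3)%N // (_ : 10 = 2 * 5)%N //.
by rewrite !(coprimeMl, coprimeXl) ?c2 ?c3 ?c5.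
Qed.

(** The companion matrix of X^2 - 5: a square root of 5 over every ring. *)
Definition sqrt5_mx (R : nzRingType) : 'M[R]_2 :=
  \matrix_(i, j) (if i == 0 then (if j == 0 then 0 else 5) else (j == 0)%:R).

Lemma sqrt5_mx_sqr (R : nzRingType) : sqrt5_mx R * sqrt5_mx R = 5.
Proof.
apply/matrixP => i j; rewrite [RHS]mulmxnE -[LHS]/((_ *m _) i j) !mxE.
rewrite !big_ord_recl big_ord0 !mxE /=.
by case: i j => [[|[|//]] ?] [[|[|//]] ?];
  rewrite /= ?(mul0r, mulr0, mulr1, mul1r, add0r, addr0, mul0rn).
Qed.

Lemma sqrt5_mx_eigen (R : comNzRingType) (w : R) : w ^+ 2 = 5 ->
  (\row_(j < 2) (if j == 0 then 1 else w)) *m sqrt5_mx R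
  = w *: \row_(j < 2) (if j == 0 then 1 else w).
Proof.
move=> w2; apply/rowP => j; rewrite !mxE !big_ord_recl big_ord0 !mxE /=.
by case: j => [[|[|//]] ?]; rewrite /= ?(mul0r, mulr0, mulr1, mul1r, add0r, addr0) -?expr2.
Qed.

Lemma row2_mulE (R : nzRingType) (u : R) (M : 'M[R]_2) (j : 'I_2) :
  ((\row_(i < 2) (if i == 0 then 1 else u)) *m M) 0 j = M 0 j + u * M 1 j.
Proof.
rewrite mxE !big_ord_recl big_ord0 !mxE /= mul1r addr0.
by congr (_ + _ * M _ _); apply: val_inj.
Qed.

Section Assembly.
Variables (p : nat) (pp : prime p) (p5 : (5 < p)%N).

(** The square of 3^((p-1)/2) is 1 and that of w^((p-1)/2) is 5^((p-1)/2),
    which is a sign. *)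
Lemma acoef_sum_sqr (L : fieldType) (iota : {rmorphism 'F_p -> L}) (w x : L) :
  w ^+ 2 = 5 -> 5 ^+ p./2 = (legendre p 5)%:~R :> L -> 25 * (864 * x) = 25 - 11 * w ->
  (\sum_(k < p) (acoef k)%:R * x ^+ k) ^+ 2
  = (legendre p 5 * cubic_sum 'F_p 1 ^+ 2)%:~R.
Proof.
move=> w2 e5 xE.
have := acoef_sum_cm12 p pp p5 L iota w x w2 xE.
move: (\sum_(k < p) _) => A /(congr1 (fun y => y ^+ 2)).
have f9 : (3 ^+ p./2) ^+ 2 = 1 :> L.
  rewrite -exprM mulnC -card_Fp_pred //.
  have -> : 3 = iota 3 by rewrite rmorph_nat.
  rewrite -rmorphXn expf_pred ?rmorph1 //.
  by rewrite -(dvdn_pcharf (pchar_Fp pp)) dvdn_prime2 // gtn_eqF // (ltn_trans _ p5).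
rewrite /= !exprMn f9 mulr1 exprAC w2 e5 sqrrN => e.
rewrite rmorphM rmorphXn /= -e mulrA -rmorphM.
have n5 : ~~ (5 %| p)%N by rewrite dvdn_prime2 // ltn_eqF.
have -> : legendre p 5 * legendre p 5 = 1 by rewrite legendre5E //; case: ifP.
by rewrite mul1r.
Qed.

Lemma intr_dvd (L : fieldType) (z : int) : p \in [pchar L] ->
  (z%:~R == 0 :> L) = (p%:Z %| z)%Z.
Proof.
move=> pL; rewrite dvdzE /= (dvdn_pcharf pL).
by case: z => k //=; rewrite NegzE rmorphN oppr_eq0.
Qed.

Lemma natr_p2 (B : nzRingType) : p%:R = 0 :> B -> (p ^ 2)%:R = 0 :> B.
Proof. by move=> B0; rewrite natrX B0 expr0n. Qed.

Lemma small_neq0 (L : fieldType) : p \in [pchar L] ->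
  [/\ 2 != 0 :> L, 3 != 0 :> L & 5 != 0 :> L].
Proof.
move=> pL; have nz k : (0 < k < p)%N -> k%:R != 0 :> L.
  by exact: (natr_neq0_lt p pp p5 L pL k).
by split; rewrite nz // (ltn_trans _ p5).
Qed.

(** With y = 864x, the equation 25y = 25 - 11w gives
    625 y(2 - y) = 625 - 121 w^2 = 20. *)
Lemma cm_point (L : fieldType) (w x : L) : p \in [pchar L] -> w ^+ 2 = 5 ->
  25 * (864 * x) = 25 - 11 * w -> (54 * 10 ^ 3)%:R * (x * (1 - 432 * x)) = 1.
Proof.
move=> pL w2 xE.
have c : 5 * 864 != 0 :> L.
  have [F2 F3 F5] := small_neq0 L pL.
  have -> : 864 = 2 ^+ 5 * 3 ^+ 3 :> L by ring.
  by rewrite !mulf_neq0 ?expf_neq0.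
rewrite natrM natrX; apply: (mulfI c).
transitivity (6 ^+ 3 * ((25 * (864 * x)) * (50 - 25 * (864 * x)))); first by ring.
rewrite xE; transitivity (6 ^+ 3 * (20 + 121 * (5 - w ^+ 2))); first by ring.
rewrite w2 subrr mulr0 addr0 mulr1; ring.
Qed.

Lemma dvd_numer_1mod3 (A B : int) : (p %% 3 = 1)%N -> p%:Z = A ^+ 2 + 3 * B ^+ 2 ->
  (p%:Z %| (ccoef_numer (54 * 10 ^ 3) p)%:Z
    - ((54 * 10 ^ 3) ^ p.-1)%:R * (legendre p 5 * 4 * A ^+ 2))%Z.
Proof.
move=> p3 pAB.
have [L [iota [z z5]]] := fifth_root_field 'F_p.
have pL := pchar_target p pp L iota.
have w2 := gauss_sum5_sqr L z z5.
have e5 := legendre5_euler p pp p5 L pL z z5.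
move: (gauss_sum5 L z) w2 => w w2.
have [x xE] : exists x : L, 25 * (864 * x) = 25 - 11 * w.
  have [F2 F3 F5] := small_neq0 L pL.
  exists ((25 - 11 * w) / (25 * 864)).
  rewrite mulrA [25 * 864 * _]mulrCA divff ?mulr1 //.
  have -> : 25 * 864 = 2 ^+ 5 * 3 ^+ 3 * 5 ^+ 2 :> L by ring.
  by rewrite !mulf_neq0 ?expf_neq0.
have := cm_point L w x pL w2 xE; move: (54 * 10 ^ 3)%N => D cm.
have n3 : (3 %| #|'F_p|.-1)%N by rewrite card_Fp //; lia.
have [A' [B' [SE pE]]] := cubic_sum_form 'F_p (odd_card_Fp p pp p5) n3.
rewrite card_Fp // natz in pE.
have AA := prime_form_uniq p A B A' B' pp pAB pE.
rewrite -(intr_dvd L) // rmorphB /= subr_eq0 rmorphM /= rmorph_nat.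
rewrite -pmulrn (ccoef_numerE _ _ _ _ cm).
rewrite clausen_mod_p2 //; last by rewrite natr_p2 // (pcharf0 pL).
rewrite (acoef_sum_sqr L iota w x) // SE AA; apply/eqP; congr (_ * _%:~R); ring.
Qed.


Lemma inverse_mod_p2 (M : nat) : coprime M p -> exists d, (M * d = 1 %[mod p ^ 2])%N.
Proof.
move=> co; have co2 : coprime M (p ^ 2) by rewrite coprimeXr.
have e1 := chinese_modl co2 0 1; have e2 := chinese_modr co2 0 1.
move: (chinese _ _ _ _) e1 e2 => x; rewrite mod0n => /eqP/dvdnP[d ->] e.
by exists d; rewrite mulnC.
Qed.

Lemma natr_mod_p2 (B : nzRingType) (k : nat) : (p ^ 2)%:R = 0 :> B ->
  (k = 1 %[mod p ^ 2])%N -> k%:R = 1 :> B.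
Proof.
move=> B0 e; rewrite (divn_eq k (p ^ 2)) natrD natrM B0 mulr0 add0r e modn_small //.
by rewrite -(exp1n 2) ltn_exp2r // prime_gt1.
Qed.

(** Matrices do not commute, so the identity is proved for polynomials in one
    variable and evaluated at W. *)
Lemma cm_point_mx (B : nzRingType) (W : B) (d : nat) : (p ^ 2)%:R = 0 :> B ->
  W * W = 5 -> (25 * 864 * d = 1 %[mod p ^ 2])%N ->
  let X := d%:R * (25 - 11 * W) in
  (54 * 10 ^ 3)%:R * (X * (1 - 432 * X)) = 1.
Proof.
move=> B0 W2 dE X.
have Bd : (25 * 864 * d)%:R = 1 :> B by apply: natr_mod_p2 dE.
have [phi phiX] : exists phi : {rmorphism {poly int} -> B}, phi 'X = W.
  have cW : commr_rmorph (intmul (1 : B)) W by move=> z; apply: commr_int.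
  by exists (horner_morph cW); apply: horner_morphX.
pose q : {poly int} := d%:R * (25 - 11 * 'X).
(* the factor 25 * 864 * d, which is 1 in B, clears the denominators of q *)
pose y : {poly int} := (25 * 864 * d)%:R * (25 - 11 * 'X).
have phin k : phi k%:R = k%:R by rewrite rmorph_nat.
have phi25 : phi (25 - 11 * 'X) = 25 - 11 * W by rewrite rmorphB rmorphM phiX !phin.
have phiq : phi q = X by rewrite /q rmorphM phi25 phin.
have phiy : phi y = phi (25 - 11 * 'X) by rewrite /y rmorphM phin Bd mul1r.
have -> : X * (1 - 432 * X) = phi (q * (1 - 432 * q)).
  have phiE r : phi (r * (1 - 432 * r)) = phi r * (1 - 432 * phi r).
    by rewrite rmorphM rmorphB rmorphM phin rmorph1.
  by rewrite phiE phiq.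
rewrite -phin -rmorphM natrM natrX.
have e : (25 * 864 * d)%:R * (54 * 10 ^+ 3 * (q * (1 - 432 * q))) =
    (d * 5 * 6 ^ 3)%:R * (y * (50 - y)) :> {poly int}.
  rewrite /y /q !natrM; ring.
have : phi ((25 * 864 * d)%:R * (54 * 10 ^+ 3 * (q * (1 - 432 * q)))) = 1.
  have phi50 r : phi (r * (50 - r)) = phi r * (50 - phi r).
    by rewrite rmorphM rmorphB phin.
  rewrite e rmorphM phi50 phiy -phi50 phin.
  have -> : (25 - 11 * 'X) * (50 - (25 - 11 * 'X)) =
      20 + 121 * (5 - 'X * 'X) :> {poly int} by ring.
  rewrite rmorphD (rmorphM phi 121) (rmorphB phi 5) (rmorphM phi 'X).
  rewrite phiX !phin W2 subrr mulr0 addr0 -natrM.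
  rewrite -[RHS]Bd; congr (_%:R); ring.
by rewrite (rmorphM phi (25 * 864 * d)%:R) phin Bd mul1r.
Qed.


Lemma cubic_sum_supersingular : (p %% 3 = 2)%N -> cubic_sum 'F_p 1 = 0.
Proof.
move=> p3; apply: cubic_sum_eq0; first exact: odd_card_Fp.
by rewrite card_Fp //; lia.
Qed.

Lemma rmorph_cm_point (R S : nzRingType) (f : {rmorphism R -> S}) d (W : R) :
  f (d%:R * (25 - 11 * W)) = d%:R * (25 - 11 * f W).
Proof.
have fn k : f k%:R = k%:R by apply: rmorph_nat.
by rewrite (rmorphM f d%:R) (rmorphB f 25) (rmorphM f 11) !fn.
Qed.

Definition cm_mx (d : nat) : 'M[int]_2 := d%:R * (25 - 11 * sqrt5_mx int).

Lemma map_sqrt5_mx (R : nzRingType) : map_mx intr (sqrt5_mx int) = sqrt5_mx R.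
Proof.
apply/matrixP => i j; rewrite !mxE.
by case: ifP => _; [case: ifP => _; rewrite ?rmorph0 ?rmorph_nat | rewrite rmorph_nat].
Qed.

Lemma map_cm_mx (R : nzRingType) d :
  map_mx intr (cm_mx d) = d%:R * (25 - 11 * sqrt5_mx R).
Proof.
rewrite /cm_mx -(map_sqrt5_mx R).
pose phi : {rmorphism 'M[int]_2 -> 'M[R]_2} := map_mx intr.
exact: (rmorph_cm_point _ _ phi).
Qed.

(** Over a field containing F_p and a square root w of 5, the rows (1, w) and
    (1, -w) are left eigenvectors of the companion matrix, on which the matrix
    sum acts by the two values of the truncated series.  Both values vanish, so
    the sum is zero modulo p. *)
Lemma acoef_cm_mx_dvd d i j : (p %% 3 = 2)%N -> (25 * 864 * d = 1 %[mod p ^ 2])%N ->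
  (p%:Z %| (\sum_(k < p) (acoef k)%:R * cm_mx d ^+ k : 'M[int]_2) i j)%Z.
Proof.
move=> p3 dE; have [L [iota [z z5]]] := fifth_root_field 'F_p.
have pL := pchar_target p pp L iota.
have w2 := gauss_sum5_sqr L z z5.
move: (gauss_sum5 L z) w2 => w w2.
have [F2 F3 F5] := small_neq0 L pL.
have w0 : w != 0 by apply: contraNneq F5 => w0; rewrite -w2 w0 expr0n.
have Ld : (25 * 864 * d)%:R = 1 :> L 
  by apply: natr_mod_p2 dE; rewrite natr_p2 // (pcharf0 pL).
pose phi : {rmorphism 'M[int]_2 -> 'M[L]_2} := map_mx intr.
set A : 'M[int]_2 := \sum_(k < p) _.
have AE : phi A = \sum_(k < p) (acoef k)%:R * (d%:R * (25 - 11 * sqrt5_mx L)) ^+ k.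
  rewrite /A rmorph_sum /=; apply: eq_bigr => k _.
  by rewrite (rmorphM phi (acoef k)%:R) rmorphXn rmorph_nat -map_cm_mx.
have kill u : u ^+ 2 = 5 -> (\row_(j < 2) (if j == 0 then 1 else u)) *m phi A = 0.
  move=> u2; set v := \row_j _; pose x := d%:R * (25 - 11 * u).
  have xE : 25 * (864 * x) = 25 - 11 * u.
    by rewrite /x !mulrA -!natrM Ld mul1r.
  have vn k (M : 'M[L]_2) : v *m (k%:R * M) = k%:R *: (v *m M).
    by rewrite mulr_natl scaler_nat; apply: (raddfMn (mulmx v)).
  have vX : v *m (d%:R * (25 - 11 * sqrt5_mx L)) = x *: v.
    have v25 := vn 25 1; rewrite mulr1 mulmx1 in v25.
    by rewrite vn mulmxBr v25 vn sqrt5_mx_eigen // scalerA -scalerBl scalerA.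
  have vXk k : v *m (d%:R * (25 - 11 * sqrt5_mx L)) ^+ k = x ^+ k *: v.
    elim: k => [|k IHk]; first by rewrite !expr0 mulmx1 scale1r.
    by rewrite exprS -mulmxE mulmxA vX -scalemxAl IHk scalerA -exprS.
  rewrite AE mulmx_sumr.
  transitivity ((\sum_(k < p) (acoef k)%:R * x ^+ k) *: v).
    by rewrite scaler_suml; apply: eq_bigr => k _; rewrite vn vXk scalerA.
  have := acoef_sum_cm12 p pp p5 L iota u x u2 xE.
  rewrite cubic_sum_supersingular // rmorph0 oppr0 => /eqP.
  have u0 : u != 0 by apply: contraNneq F5 => u0; rewrite -u2 u0 expr0n.
  rewrite !mulf_eq0 !expf_eq0 (negPf u0) (negPf F3) !andbF /= => /eqP->.
  by rewrite scale0r.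
rewrite -(intr_dvd L) //.
have e (u : L) : u ^+ 2 = 5 -> phi A 0 j + u * phi A 1 j = 0.
  by move=> u2; rewrite -row2_mulE kill // mxE.
have e1 := e w w2; have e2 := e (- w); rewrite sqrrN in e2; move/(_ w2): e2 => e2.
have A0 : phi A 0 j = 0.
  apply: (mulfI F2); rewrite mulr0 -[RHS]addr0 -{1}e1 -e2; ring.
have A1 : phi A 1 j = 0.
  by move: e1; rewrite A0 add0r => /eqP; rewrite mulf_eq0 (negPf w0) /= => /eqP.
have : phi A i j = 0.
  by case: i => [[|[|//]] ?]; [rewrite -[RHS]A0 | rewrite -[RHS]A1];
    congr (phi A _ j); apply: val_inj.
by rewrite /phi /= mxE => ->.
Qed.

Lemma dvd_numer_2mod3 : (p %% 3 = 2)%N -> (p ^ 2 %| ccoef_numer (54 * 10 ^ 3) p)%N.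
Proof.
move=> p3; have [d dE] : exists d, (25 * 864 * d = 1 %[mod p ^ 2])%N.
  apply: inverse_mod_p2.
  have co k : (0 < k < p)%N -> coprime k p.
    by move=> kp; rewrite coprime_sym (coprime_lt_prime p pp).
  have c2 : coprime 2 p by rewrite co // (ltn_trans _ p5).
  have c3 : coprime 3 p by rewrite co // (ltn_trans _ p5).
  have c5 : coprime 5 p by rewrite co.
  rewrite (_ : 25 = 5 * 5)%N // (_ : 864 = 2 ^ 5 * 3 ^ 3)%N //.
  by rewrite !(coprimeMl, coprimeXl) ?c2 ?c3 ?c5.
have p2 : (1 < p ^ 2)%N by rewrite -(exp1n 2) ltn_exp2r // prime_gt1.
have Z0 : (p ^ 2)%:R = 0 :> 'Z_(p ^ 2) by apply: pchar_Zp.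
have B0 : (p ^ 2)%:R = 0 :> 'M['Z_(p ^ 2)]_2.
  by apply/matrixP => i j; rewrite mulmxnE -mulr_natl Z0 mul0r mxE.
have cm := cm_point_mx _ (sqrt5_mx _) d B0 (sqrt5_mx_sqr _) dE.
move: (54 * 10 ^ 3)%N cm => D cm.
have := @ccoef_numerE D p _ _ cm.
rewrite clausen_mod_p2 //.
pose phi : {rmorphism 'M[int]_2 -> 'M['Z_(p ^ 2)]_2} := map_mx intr.
pose A : 'M[int]_2 := \sum_(k < p) (acoef k)%:R * cm_mx d ^+ k.
have -> : \sum_(k < p) (acoef k)%:R * (d%:R * (25 - 11 * sqrt5_mx 'Z_(p ^ 2))) ^+ k
    = phi A.
  rewrite /A rmorph_sum /=; apply: eq_bigr => k _.
  by rewrite (rmorphM phi (acoef k)%:R) rmorphXn rmorph_nat -map_cm_mx.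
have -> : A = p%:R * map_mx (fun z => (z %/ p%:Z)%Z) A.
  apply/matrixP => i j; rewrite mulr_natl mulmxnE mxE -mulr_natr natz divzK //.
  exact: acoef_cm_mx_dvd.
rewrite (rmorphM phi p%:R) rmorph_nat (mulr_natl _ p) exprMn_n.
rewrite -(mulr_natl _ (p ^ 2)) B0 mul0r mulr0.
move/matrixP/(_ 0 0); rewrite mulmxnE !mxE /= => /(congr1 val).
by rewrite /= val_Zp_nat // => /eqP.
Qed.

End Assembly.

Theorem theorem4p12 (p : nat) (hp : prime p) (hp5 : (5 < p)%N) :
  ((p = 2 %[mod 3])%N ->
     rat_congr p (p ^ 2)
       (\sum_(0 <= k < p)
          ('C(2 * k, k) * 'C(3 * k, k) * 'C(6 * k, 3 * k))%N%:R / (54 * 10 ^+ 3) ^+ k)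
       0) /\
  ((p = 1 %[mod 3])%N ->
     (exists A B : int, p%:Z = A ^+ 2 + 3 * B ^+ 2) /\
     (forall A B : int, p%:Z = A ^+ 2 + 3 * B ^+ 2 ->
        rat_congr p p
          (\sum_(0 <= k < p)
             ('C(2 * k, k) * 'C(3 * k, k) * 'C(6 * k, 3 * k))%N%:R / (54 * 10 ^+ 3) ^+ k)
          (legendre p%:Z 5 * 4 * A ^+ 2)%:~R)).
Proof.
have M0 : (0 < (54 * 10 ^ 3) ^ p.-1)%N by rewrite expn_gt0 denominator_gt0.
have co : coprime ((54 * 10 ^ 3) ^ p.-1) p by rewrite coprimeXl // coprime_denominator.
rewrite ccoef_sum_frac; split => p3.
  have d2 := dvd_numer_2mod3 p hp hp5 p3.
  move: (54 * 10 ^ 3)%N M0 co d2 => D M0 co d2.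
  rewrite -[0]/(0%:~R); apply: rat_congr_frac => //.
  by rewrite mulr0 subr0.
split.
  have n3 : (3 %| #|'F_p|.-1)%N by rewrite card_Fp //; lia.
  have [A [B [_ AB]]] := cubic_sum_form 'F_p (odd_card_Fp p hp hp5) n3.
  by exists A, B; rewrite -AB card_Fp // natz.
move=> A B AB; have := dvd_numer_1mod3 p hp hp5 A B p3 AB.
move: (54 * 10 ^ 3)%N M0 co => D M0 co d1.
exact: rat_congr_frac.
Qed.
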